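(* Let $\Bbbk$ be a field, $n\ge1$, let $R$ be a Poisson $\Bbbk$-algebra, $\boldsymbol\partial=(\partial_1,\dots,\partial_n)$ an $n$-tuple of commuting Poisson derivations of $R$, $\mathbf a=(a_1,\dots,a_n)$ an $n$-tuple of regular Poisson central elements of $R$, and $\mu_{ij},\gamma_{ij}\in\Bbbk$ scalars with $\partial_j(a_i)=\gamma_{ij}a_i$ and $\gamma_{ij}+\gamma_{ji}=\mu_{ij}+\mu_{ji}$ for all $i\ne j$. Let $T_0=R[x_1;\partial_1]_P\cdots[x_n;\partial_n]_P$ be the iterated Poisson Ore extension in which each $\partial_k$ ($k=2,\dots,n$) is extended to the previous stage by $\partial_k(x_i)=(\mu_{ki}-\gamma_{ki})x_i$ for $i<k$. Let $T=T_0[y_1;\phi_1,\psi_1]_P\cdots[y_n;\phi_n,\psi_n]_P$ be the iterated Poisson Ore extension in which $\phi_k,\psi_k$ are the derivations determined by: $\phi_k(r)=-\partial_k(r)$ and $\psi_k(r)=0$ for $r\in R$; $\phi_k(x_k)=0$ and $\phi_k(x_i)=-\mu_{ki}x_i$ for $i\ne k$; $\psi_k(x_k)=-\partial_k(a_k)$ and $\psi_k(x_i)=0$ for $i\neq k$; and $\phi_k(y_i)=(\gamma_{ki}-\mu_{ik})y_i$, $\psi_k(y_i)=0$ for $i<k$. Then $A_\mu(R,\boldsymbol\partial,\mathbf a)\cong T/(y_ix_i-a_i\mid i=1,\dots,n)$ as Poisson algebras.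
   Context: A Poisson algebra is a commutative $\Bbbk$-algebra $R$ with a Lie bracket $\{,\}$ such that each $\{r,-\}$ is a derivation. A derivation $\partial$ of $R$ is a Poisson derivation if $\partial(\{r,s\})=\{\partial(r),s\}+\{r,\partial(s)\}$ for all $r,s$. An element $a$ is Poisson central if $\{a,-\}=0$. Given a Poisson derivation $\partial$ of $R$, a derivation $\delta$ of $R$ is a Poisson $\partial$-derivation if $\delta(\{a,b\})=\{\delta(a),b\}+\{a,\delta(b)\}-\partial(a)\delta(b)+\delta(a)\partial(b)$ for all $a,b\in R$. The Poisson Ore extension $R[t;\partial,\delta]_P$ is the polynomial ring $R[t]$ with the Poisson bracket extending that of $R$ with $\{r,t\}=\partial(r)t+\delta(r)$ for $r\in R$; write $R[t;\partial]_P$ when $\delta=0$. The twisted generalized Weyl Poisson algebra $A_\mu(R,\boldsymbol\partial,\mathbf a)$ of type $(A_1)^n$ is the algebra $R[x_1,y_1,\dots,x_n,y_n]/(y_1x_1-a_1,\dots,y_nx_n-a_n)$ with Poisson bracket extending that of $R$ and given by $\{r,x_i\}=\partial_i(r)x_i$, $\{r,y_i\}=-\partial_i(r)y_i$, $\{y_i,x_i\}=\partial_i(a_i)$ for all $i$ and $r\in R$, and $\{y_i,x_j\}=\mu_{ij}x_jy_i$, $\{x_i,x_j\}=(\gamma_{ij}-\mu_{ij})x_ix_j$, $\{y_i,y_j\}=(\mu_{ji}-\gamma_{ij})y_iy_j$ for $i\ne j$. *)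

(* Defs.v *)
From HB Require Import structures.
From mathcomp Require Import all_boot all_order all_algebra.
From mathcomp Require Import ring_quotient.
From mathcomp Require Import boolp.
From mathcomp Require Import mpoly.

Set Implicit Arguments.
Unset Strict Implicit.
Unset Printing Implicit Defensive.

Import GRing.Theory.
Local Open Scope ring_scope.
Local Open Scope quotient_scope.

Section PoissonAlgebras.
Variable k : fieldType.

Definition derivation (A : comAlgType k) (d : A -> A) : Prop :=
  linear d /\ forall u v, d (u * v) = d u * v + u * d v.

Record poisson_bracket (A : comAlgType k) (b : A -> A -> A) : Prop := {
  pb_linearl : forall v, linear (fun u => b u v);
  pb_alternating : forall u, b u u = 0;
  pb_jacobi : forall u v w, b u (b v w) + b v (b w u) + b w (b u v) = 0;
  pb_derivation : forall u, derivation (b u)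
}.

Definition poisson_derivation (A : comAlgType k) (b : A -> A -> A)
    (d : A -> A) : Prop :=
  derivation d /\ forall u v, d (b u v) = b (d u) v + b u (d v).

Definition poisson_skew_derivation (A : comAlgType k) (b : A -> A -> A)
    (d e : A -> A) : Prop :=
  derivation e /\
  forall u v, e (b u v) = b (e u) v + b u (e v) - d u * e v + e u * d v.

Definition poisson_central (A : comAlgType k) (b : A -> A -> A) (z : A) : Prop :=
  forall u, b z u = 0.

Definition poisson_isomorphic (A B : comAlgType k)
    (bA : A -> A -> A) (bB : B -> B -> B) : Prop :=
  exists2 f : {lrmorphism A -> B}, bijective f &
    forall u v, f (bA u v) = bB (f u) (f v).

End PoissonAlgebras.

(* [{poly A}] comes with its [A]-algebra structure; this alias carries the     *)
(* [k]-algebra structure inherited from that of [A].                          *)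
Definition polyAlg (k : fieldType) (A : comAlgType k) : Type := {poly A}.

Section PolyAlg.
Variables (k : fieldType) (A : comAlgType k).
HB.instance Definition _ := GRing.ComNzRing.on (polyAlg A).

Let scale (c : k) (p : polyAlg A) : polyAlg A := (c%:A)%:P * p.

Let scaleA c e p : scale c (scale e p) = scale (c * e) p.
Proof. by rewrite /scale mulrA -polyCM -scalerAl mul1r scalerA. Qed.
Let scale1 : left_id 1 scale.
Proof. by move=> p; rewrite /scale scale1r polyC1 mul1r. Qed.
Let scaleDr : right_distributive scale +%R.
Proof. by move=> c p q; rewrite /scale mulrDr. Qed.
Let scaleDl p : {morph scale^~ p : c e / c + e}.
Proof. by move=> c e; rewrite /scale scalerDl polyCD mulrDl. Qed.

HB.instance Definition _ :=
  GRing.Zmodule_isLmodule.Build k (polyAlg A) scaleA scale1 scaleDr scaleDl.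

Let scaleAl (c : k) (p q : polyAlg A) : c *: (p * q) = (c *: p) * q.
Proof. exact: mulrA. Qed.
HB.instance Definition _ :=
  GRing.Lmodule_isLalgebra.Build k (polyAlg A) scaleAl.
HB.instance Definition _ := GRing.Lalgebra_isComAlgebra.Build k (polyAlg A).
End PolyAlg.

Definition mpolyAlg (k : fieldType) (A : comAlgType k) (m : nat) : Type :=
  {mpoly A[m]}.

Section MpolyAlg.
Variables (k : fieldType) (A : comAlgType k) (m : nat).
HB.instance Definition _ := GRing.ComNzRing.on (mpolyAlg A m).

Let scale (c : k) (p : mpolyAlg A m) : mpolyAlg A m := (c%:A)%:MP_[m] * p.

Let scaleA c e p : scale c (scale e p) = scale (c * e) p.
Proof. by rewrite /scale mulrA -mpolyCM -scalerAl mul1r scalerA. Qed.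
Let scale1 : left_id 1 scale.
Proof. by move=> p; rewrite /scale scale1r mpolyC1 mul1r. Qed.
Let scaleDr : right_distributive scale +%R.
Proof. by move=> c p q; rewrite /scale mulrDr. Qed.
Let scaleDl p : {morph scale^~ p : c e / c + e}.
Proof. by move=> c e; rewrite /scale scalerDl mpolyCD mulrDl. Qed.

HB.instance Definition _ :=
  GRing.Zmodule_isLmodule.Build k (mpolyAlg A m) scaleA scale1 scaleDr scaleDl.

Let scaleAl (c : k) (p q : mpolyAlg A m) : c *: (p * q) = (c *: p) * q.
Proof. exact: mulrA. Qed.
HB.instance Definition _ :=
  GRing.Lmodule_isLalgebra.Build k (mpolyAlg A m) scaleAl.
HB.instance Definition _ := GRing.Lalgebra_isComAlgebra.Build k (mpolyAlg A m).
End MpolyAlg.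

Definition in_ideal (A : comNzRingType) (m : nat) (g : 'I_m -> A) (z : A) : Prop :=
  exists c : 'I_m -> A, z = \sum_i c i * g i.

Lemma ideal_proper (A B : comNzRingType) (m : nat) (g : 'I_m -> A)
  (f : {rmorphism A -> B}) : (forall i, f (g i) = 0) -> ~ in_ideal g 1.
Proof.
move=> fg [c] /(congr1 f); rewrite rmorph1 rmorph_sum big1 => [/eqP|i _].
  by rewrite oner_eq0.
by rewrite rmorphM fg mulr0.
Qed.

(* A / (g_1, .., g_m). MathComp rings are nontrivial, hence the properness     *)
(* argument.                                                                  *)
Definition gideal (A : comNzRingType) (m : nat) (g : 'I_m -> A)
  (gP : ~ in_ideal g 1) : A -> bool := fun z => `[< in_ideal g z >].

Section QuotAlg.
Variables (k : fieldType) (A : comAlgType k) (m : nat) (g : 'I_m -> A).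
Variable gP : ~ in_ideal g 1.

Let gidealP : idealr_closed (gideal gP).
Proof.
split=> [||u v w].
- by apply/asboolP; exists (fun=> 0); rewrite big1 // => i _; rewrite mul0r.
- by apply/asboolP.
move=> /asboolP [c ->] /asboolP [e ->]; apply/asboolP.
exists (fun i => u * c i + e i); rewrite mulr_sumr -big_split /=.
by apply: eq_bigr => i _; rewrite mulrDl mulrA.
Qed.
HB.instance Definition _ := isIdealr.Build A (gideal gP) gidealP.

Let I : idealr A := gideal gP.

Definition quotAlg : Type := {ideal_quot I}.
HB.instance Definition _ := GRing.ComNzRing.on quotAlg.

Definition quot_pi (u : A) : quotAlg := \pi_{ideal_quot I} u.

Let quot_piB : zmod_morphism quot_pi.
Proof. exact: rmorphB. Qed.
HB.instance Definition _ := GRing.isZmodMorphism.Build A quotAlg quot_pi quot_piB.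
Let quot_piM : monoid_morphism quot_pi.
Proof. by split; [exact: rmorph1 | exact: rmorphM]. Qed.
HB.instance Definition _ := GRing.isMonoidMorphism.Build A quotAlg quot_pi quot_piM.

Let scale (c : k) (x : quotAlg) : quotAlg := quot_pi c%:A * x.

Let scaleA c e x : scale c (scale e x) = scale (c * e) x.
Proof. by rewrite /scale mulrA -rmorphM -scalerAl mul1r scalerA. Qed.
Let scale1 : left_id 1 scale.
Proof. by move=> x; rewrite /scale scale1r rmorph1 mul1r. Qed.
Let scaleDr : right_distributive scale +%R.
Proof. by move=> c x y; rewrite /scale mulrDr. Qed.
Let scaleDl x : {morph scale^~ x : c e / c + e}.
Proof. by move=> c e; rewrite /scale scalerDl rmorphD mulrDl. Qed.

HB.instance Definition _ :=
  GRing.Zmodule_isLmodule.Build k quotAlg scaleA scale1 scaleDr scaleDl.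
Let scaleAl (c : k) (x y : quotAlg) : c *: (x * y) = (c *: x) * y.
Proof. exact: mulrA. Qed.
HB.instance Definition _ := GRing.Lmodule_isLalgebra.Build k quotAlg scaleAl.
HB.instance Definition _ := GRing.Lalgebra_isComAlgebra.Build k quotAlg.

Definition quotient_bracket (b : A -> A -> A)
    (bq : quotAlg -> quotAlg -> quotAlg) : Prop :=
  poisson_bracket bq /\
  forall u v, bq (quot_pi u) (quot_pi v) = quot_pi (b u v).

End QuotAlg.

Section IteratedOre.
Variable k : fieldType.

(* [b'] makes the polynomial ring in one variable over [(A, b)] into the       *)
(* Poisson Ore extension [A[t; d, e]_P], with [t = 'X].                        *)
Record poisson_ore (A : comAlgType k) (b : A -> A -> A) (d e : A -> A)
    (b' : polyAlg A -> polyAlg A -> polyAlg A) : Prop := {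
  po_derivation : poisson_derivation b d;
  po_skew_derivation : poisson_skew_derivation b d e;
  po_bracket : poisson_bracket b';
  po_const : forall r s, b' r%:P s%:P = (b r s)%:P;
  po_var : forall r, b' r%:P 'X = (d r)%:P * 'X + (e r)%:P
}.

(* A[t_0] .. [t_(m-1)] *)
Fixpoint ipoly (A : comAlgType k) (m : nat) : comAlgType k :=
  if m is l.+1 then polyAlg (ipoly A l) else A.

Fixpoint iconst (A : comAlgType k) (m : nat) (r : A) : ipoly A m :=
  if m is l.+1 return ipoly A m then (iconst l r)%:P else r.

(* The variable t_i, for i < m (and 0 otherwise). *)
Fixpoint ivar (A : comAlgType k) (m i : nat) : ipoly A m :=
  if m is l.+1 return ipoly A m then
    if i == l then 'X else (ivar A l i)%:P
  else 0.

(* [B] is the bracket of an iterated Poisson Ore extension                    *)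
(* [A[t_0; d_0, e_0]_P .. [t_(m-1); d_(m-1), e_(m-1)]_P] whose [l]-th pair of *)
(* maps [d_l, e_l] on [A[t_0] .. [t_(l-1)]] satisfies [step l].               *)
Fixpoint iterated_ore (A : comAlgType k) (b : A -> A -> A)
    (step : forall l, (ipoly A l -> ipoly A l) -> (ipoly A l -> ipoly A l) -> Prop)
    (m : nat) : (ipoly A m -> ipoly A m -> ipoly A m) -> Prop :=
  if m is l.+1 return (ipoly A m -> ipoly A m -> ipoly A m) -> Prop
  then fun B => exists B' d e,
    [/\ iterated_ore b step B', step l d e & poisson_ore B' d e B]
  else fun B => B = b.

Lemma ipoly_eval (A : comAlgType k) (v : nat -> A) (m : nat) :
  exists2 f : {rmorphism ipoly A m -> A},
    forall r, f (iconst m r) = r & forall i, (i < m)%N -> f (ivar A m i) = v i.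
Proof.
elim: m => [|m [f fC fX]]; first by exists idfun.
have cfv : commr_rmorph f (v m) by move=> x; apply: mulrC.
exists (horner_morph cfv : {rmorphism polyAlg (ipoly A m) -> A}) => [r|i].
  by rewrite /= horner_morphC fC.
rewrite ltnS leq_eqVlt /=; case: eqP => [->|_] im; first by rewrite horner_morphX.
by rewrite horner_morphC fX.
Qed.

End IteratedOre.

Section TwistedGWPA.
Variables (k : fieldType) (n : nat) (R : comAlgType k) (br : R -> R -> R).
Variables (d : 'I_n -> R -> R) (a : 'I_n -> R) (mu gamma : 'I_n -> 'I_n -> k).

(* In R[x_1, y_1, .., x_n, y_n], represented as {mpoly R[n + n]}, the first n  *)
(* variables are the x_i and the last n ones are the y_i.                     *)
Definition gwpa_rel (i : 'I_n) : mpolyAlg R (n + n) :=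
  'X_(rshift n i) * 'X_(lshift n i) - (a i)%:MP.

Lemma gwpa_proper : ~ in_ideal gwpa_rel 1.
Proof.
pose v (i : 'I_(n + n)) := if split i is inl j then a j else 1.
apply: (@ideal_proper _ _ _ _ (meval v : {rmorphism mpolyAlg R (n + n) -> R})).
move=> i; rewrite /gwpa_rel rmorphB rmorphM /= !mevalXU mevalC.
have -> : v (lshift n i) = a i by rewrite /v (unsplitK (inl i)).
have -> : v (rshift n i) = 1 by rewrite /v (unsplitK (inr i)).
by rewrite mul1r subrr.
Qed.

Definition gwpa : comAlgType k := quotAlg gwpa_proper.

Definition gwpa_const (r : R) : gwpa := quot_pi gwpa_proper r%:MP.
Definition gwpa_x (i : 'I_n) : gwpa := quot_pi gwpa_proper 'X_(lshift n i).
Definition gwpa_y (i : 'I_n) : gwpa := quot_pi gwpa_proper 'X_(rshift n i).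

(* [b] is the Poisson bracket of A_mu(R, d, a). *)
Record gwpa_bracket (b : gwpa -> gwpa -> gwpa) : Prop := {
  gwpa_poisson : poisson_bracket b;
  gwpa_rr : forall r s, b (gwpa_const r) (gwpa_const s) = gwpa_const (br r s);
  gwpa_rx : forall r i, b (gwpa_const r) (gwpa_x i) = gwpa_const (d i r) * gwpa_x i;
  gwpa_ry : forall r i,
    b (gwpa_const r) (gwpa_y i) = - (gwpa_const (d i r) * gwpa_y i);
  gwpa_yx : forall i, b (gwpa_y i) (gwpa_x i) = gwpa_const (d i (a i));
  gwpa_yx_neq : forall i j, i != j ->
    b (gwpa_y i) (gwpa_x j) = mu i j *: (gwpa_x j * gwpa_y i);
  gwpa_xx : forall i j, i != j ->
    b (gwpa_x i) (gwpa_x j) = (gamma i j - mu i j) *: (gwpa_x i * gwpa_x j);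
  gwpa_yy : forall i j, i != j ->
    b (gwpa_y i) (gwpa_y j) = (mu j i - gamma i j) *: (gwpa_y i * gwpa_y j)
}.

Definition oreT0 : comAlgType k := ipoly R n.

Definition oreT0_step (l : nat) (D E : ipoly R l -> ipoly R l) : Prop :=
  forall j : 'I_n, j = l :> nat ->
  [/\ forall r, D (iconst l r) = iconst l (d j r),
      forall i : 'I_n, (i < j)%N ->
        D (ivar R l i) = (mu j i - gamma j i) *: ivar R l i
    & forall u, E u = 0].

Definition oreT0_bracket : (oreT0 -> oreT0 -> oreT0) -> Prop :=
  iterated_ore br oreT0_step (m := n).

Definition oreT : comAlgType k := ipoly oreT0 n.

Definition oreT_step (l : nat) (phi psi : ipoly oreT0 l -> ipoly oreT0 l) : Prop :=
  let c (r : R) : ipoly oreT0 l := iconst l (iconst n r) in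
  let x (i : 'I_n) : ipoly oreT0 l := iconst l (ivar R n i) in
  let y (i : 'I_n) : ipoly oreT0 l := ivar oreT0 l i in
  forall j : 'I_n, j = l :> nat ->
  [/\ forall r, phi (c r) = - c (d j r) /\ psi (c r) = 0,
      phi (x j) = 0 /\ psi (x j) = - c (d j (a j)),
      forall i, i != j -> phi (x i) = - mu j i *: x i /\ psi (x i) = 0
    & forall i : 'I_n, (i < j)%N ->
        phi (y i) = (gamma j i - mu i j) *: y i /\ psi (y i) = 0].

Definition oreT_bracket (b : oreT -> oreT -> oreT) : Prop :=
  exists2 b0, oreT0_bracket b0 & iterated_ore b0 oreT_step b.

Definition oreT_rel (i : 'I_n) : oreT :=
  ivar oreT0 n i * iconst n (ivar R n i) - iconst n (iconst n (a i)).

Lemma oreT_proper : ~ in_ideal oreT_rel 1.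
Proof.
pose w i := if insub i is Some j then a j else 0.
have [f fC fX] := ipoly_eval w n.
have [g gC gX] := @ipoly_eval k oreT0 (fun=> 1) n.
apply: (@ideal_proper _ _ _ _ (f \o g : {rmorphism oreT -> R})) => i.
rewrite /oreT_rel rmorphB rmorphM /= !gC gX // rmorph1 mul1r fC fX //.
by rewrite /w insubT //= => ?; rewrite (_ : Sub _ _ = i) ?subrr //; apply: val_inj.
Qed.

Definition quotT : comAlgType k := quotAlg oreT_proper.

End TwistedGWPA.

(* Main.v *)
Require Import Defs.
From HB Require Import structures.
From mathcomp Require Import all_boot all_order all_algebra.
From mathcomp Require Import ring_quotient boolp ring.
From mathcomp Require mpoly.

(* A Poisson bracket, and the (skew) derivation identities that a Poisson Ore *)
(* extension requires, need only be checked on algebra generators, because    *)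
(* the defects are derivations in each argument. On A[t] the bracket is built *)
(* by extending {r, -} and {t, -} to derivations of A[t], and then {-, q}. As *)
(* a_i and partial_i(a_i) are Poisson central, checking the pairs among       *)
(* r, x_i, y_j shows that every stage of T exists and that {y_i x_i - a_i, -} *)
(* takes values in the principal ideal of y_i x_i - a_i, so the bracket of T  *)
(* descends. The universal properties of polynomial rings identify A_mu and   *)
(* T/(y_i x_i - a_i) as algebras; transporting the bracket gives one with the *)
(* table of A_mu, and this table determines the bracket.                      *)

Set Implicit Arguments.
Unset Strict Implicit.
Unset Printing Implicit Defensive.

Import GRing.Theory.
Local Open Scope ring_scope.

(** * Brackets and derivations on generators *)

(** The checks on generators succeed for a reason of weights. On the x_i and y_i already present,
    the extended partial_j and phi_j act by scalars, and the bracket of two of these generators is a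
    scalar multiple of their product, except for {y_i, x_i} = partial_i(a_i). There the weights of
    x_i and y_i must add up to that of partial_i(a_i), which is where gamma_ij + gamma_ji = mu_ij +
    mu_ji enters. Pairs involving R use that the partial_j are commuting Poisson derivations. Since
    psi_j vanishes on all generators but x_j, its identities reduce to two facts: partial_j(a_j) is
    Poisson central, and partial_i(partial_j(a_j)) = gamma_ji partial_j(a_j) for i distinct from j.

    These checks are [x_step], [y_step] and [rel_poisson]. [ore_exists] turns the first two into the
    brackets of T_0 and T, and [quotient_bracket_exists] uses the third to descend to the quotient.
    The isomorphism [gwpa_quotT_iso] is purely algebraic. Pulling the bracket back along it proves
    that A_mu has its bracket at all, and [xy_bracket_unique] makes the isomorphism Poisson for any
    given bracket of A_mu. *)

Section Calculus.
Variables (k : fieldType) (A : comAlgType k).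

(** Phrased as an induction principle, ready for [elim/gG]. Scaling by [k] is not among the closure
    operations, so the generators must supply the constants, as the image of [R] does below. *)
Definition generated (G : A -> Prop) : Prop := forall P : A -> Prop,
  (forall u, G u -> P u) -> (forall u v, P u -> P v -> P (u + v)) ->
  (forall u v, P u -> P v -> P (u * v)) -> forall u, P u.

Lemma derivationD (d : A -> A) : derivation d -> {morph d : u v / u + v}.
Proof. by case=> dL _ u v; have := dL 1 u v; rewrite !scale1r. Qed.

Lemma derivation0 (d : A -> A) : derivation d -> d 0 = 0.
Proof. by move=> /derivationD dD; apply: (addrI (d 0)); rewrite -dD !addr0. Qed.

Lemma derivationZ (d : A -> A) c u : derivation d -> d (c *: u) = c *: d u.
Proof.
by move=> dd; case: (dd) => dL _; have := dL c u 0; rewrite (derivation0 dd) !addr0.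
Qed.

Lemma derivationN (d : A -> A) : derivation d -> {morph d : u / - u}.
Proof. by move=> dd u; rewrite -scaleN1r derivationZ // scaleN1r. Qed.

Lemma derivation1 (d : A -> A) : derivation d -> d 1 = 0.
Proof.
by case=> _ dM; apply: (addrI (d 1)); have := dM 1 1; rewrite !mulr1 mul1r addr0.
Qed.

Lemma derivation_null : derivation (fun=> 0 : A).
Proof. by split=> [c u v|u v]; rewrite ?scaler0 ?mul0r ?mulr0 addr0. Qed.

Lemma derivation_opp (d : A -> A) : derivation d -> derivation (fun u => - d u).
Proof.
by case=> dL dM; split=> [c u v|u v]; rewrite ?dL ?dM ?opprD ?scalerN ?mulNr ?mulrN.
Qed.

(** Scaling by c is multiplication by [c%:A], so the Leibniz rule gives linearity once scalars are
    killed. *)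
Lemma additive_derivation (d : A -> A) : {morph d : u v / u + v} ->
  (forall u v, d (u * v) = d u * v + u * d v) -> (forall c, d c%:A = 0) ->
  derivation d.
Proof.
move=> dD dM d0; split=> // c u v; rewrite dD; congr (_ + _).
by rewrite -mulr_algl dM d0 mul0r add0r mulr_algl.
Qed.

Section Bracket.
Variable b : A -> A -> A.
Hypothesis hb : poisson_bracket b.

Lemma pb_addl w : {morph b^~ w : u v / u + v}.
Proof. by move=> u v; have := pb_linearl hb w 1 u v; rewrite !scale1r. Qed.

Lemma pb_antisym u v : b u v = - b v u.
Proof.
have := pb_alternating hb (u + v); rewrite pb_addl.
rewrite !(derivationD (pb_derivation hb _)) !(pb_alternating hb) add0r addr0.
by move=> H; apply/eqP; rewrite -addr_eq0 H.
Qed.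

Lemma pb_scalel c u v : b (c *: u) v = c *: b u v.
Proof.
by rewrite pb_antisym (derivationZ _ _ (pb_derivation hb _)) -scalerN -pb_antisym.
Qed.

Lemma pb_oppl u v : b (- u) v = - b u v.
Proof. by rewrite -scaleN1r pb_scalel scaleN1r. Qed.

Lemma pb_mulr u v w : b u (v * w) = b u v * w + v * b u w.
Proof. exact: (pb_derivation hb u).2. Qed.

Lemma pb_mull u v w : b (u * v) w = b u w * v + u * b v w.
Proof.
by rewrite pb_antisym pb_mulr (pb_antisym u) (pb_antisym v) mulNr mulrN opprD.
Qed.

Lemma pb_addr u : {morph b u : v w / v + w}.
Proof. exact: derivationD (pb_derivation hb u). Qed.

Lemma pb_oppr u v : b u (- v) = - b u v.
Proof. exact: derivationN (pb_derivation hb u) _. Qed.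

Lemma pb_scaler c u v : b u (c *: v) = c *: b u v.
Proof. exact: derivationZ (pb_derivation hb u). Qed.

Lemma pb_0r u : b u 0 = 0.
Proof. exact: derivation0 (pb_derivation hb u). Qed.

Lemma pb_0l u : b 0 u = 0.
Proof. by rewrite pb_antisym pb_0r oppr0. Qed.

Definition skew_at (d e : A -> A) u v :=
  e (b u v) = b (e u) v + b u (e v) - d u * e v + e u * d v.

Lemma skew_at_sym (d e : A -> A) u v : derivation e ->
  skew_at d e u v -> skew_at d e v u.
Proof.
rewrite /skew_at => de H; rewrite (pb_antisym v u) (derivationN de) H.
rewrite (pb_antisym v) (pb_antisym (e v)); ring.
Qed.

(** The defect of the identity is a derivation in u, because the mixed terms of the Leibniz
    expansions cancel, and it is antisymmetric in u and v. *)
Lemma skew_derivation_gen (G : A -> Prop) (d e : A -> A) : generated G ->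
  derivation d -> derivation e ->
  (forall u v, G u -> G v -> skew_at d e u v) -> poisson_skew_derivation b d e.
Proof.
move=> gG dd de hG; split=> // u v.
(* Frees the first argument while the second stays in [H]: used with [H] equal to [G] and, after a
   swap, with no constraint. *)
have step (H : A -> Prop) : (forall u v, G u -> H v -> skew_at d e u v) ->
    forall u v, H v -> skew_at d e u v.
  move=> hH {u v} u v Hv; elim/gG: u => [u Gu|u u' hu hu'|u u' hu hu'].
  - exact: hH.
  - rewrite /skew_at in hu hu' *.
    rewrite (derivationD de u) (derivationD dd u) !pb_addl (derivationD de) hu hu'.
    ring.
  - rewrite /skew_at in hu hu' *.
    rewrite pb_mull (derivationD de) !de.2 !dd.2 hu hu' !pb_addl !pb_mull; ring.
apply: (step (fun=> True)) => // {}u {}v Gu _.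
by apply: skew_at_sym => //; apply: (step _ hG).
Qed.

(** A Poisson derivation is a skew one relative to the zero derivation. *)
Lemma derivation_gen (G : A -> Prop) (d : A -> A) : generated G ->
  derivation d ->
  (forall u v, G u -> G v -> d (b u v) = b (d u) v + b u (d v)) ->
  poisson_derivation b d.
Proof.
move=> gG dd hG; split=> // u v.
have [|_ ->] := @skew_derivation_gen G (fun=> 0) d gG derivation_null dd.
  by move=> {}u {}v Gu Gv; rewrite /skew_at hG // mul0r mulr0 subr0 addr0.
by rewrite mul0r mulr0 subr0 addr0.
Qed.

End Bracket.

(* The diagonal is a separate hypothesis because of characteristic 2. *)
Lemma poisson_bracket_gen (G : A -> Prop) (b : A -> A -> A) : generated G ->
  (forall v, derivation (b^~ v)) -> (forall u, derivation (b u)) ->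
  (forall u v, G u -> G v -> b u v = - b v u) ->
  (forall u, G u -> b u u = 0) ->
  (forall u v w, G u -> G v -> G w ->
     b u (b v w) + b v (b w u) + b w (b u v) = 0) ->
  poisson_bracket b.
Proof.
move=> gG dl dr hC hA hJ.
have bC u v : b u v = - b v u.
  elim/gG: u v => [u Gu|u u' hu hu'|u u' hu hu'] v.
  - elim/gG: v => [v Gv|v v' hv hv'|v v' hv hv']; first exact: hC.
    + by rewrite (derivationD (dl _)) (derivationD (dr _)) hv hv' opprD.
    + rewrite (dl _).2 (dr _).2 hv hv'; ring.
  - by rewrite (derivationD (dl _)) (derivationD (dr _)) hu hu' opprD.
  - rewrite (dl _).2 (dr _).2 hu hu'; ring.
have lin v : linear (b^~ v) by case: (dl v).
split=> // [u|].
  elim/gG: u => [u Gu|u v hu hv|u v hu hv]; first exact: hA.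
  - rewrite (derivationD (dl _)) !(derivationD (dr _)) hu hv (bC v u); ring.
  - rewrite (dl _).2 !(dr _).2 hu hv (bC v u); ring.
pose J u v w := b u (b v w) + b v (b w u) + b w (b u v).
have Jrot u v w : J u v w = J v w u by rewrite /J -addrA addrC.
have step (H : A -> A -> Prop) : (forall u v w, G u -> H v w -> J u v w = 0) ->
    forall u v w, H v w -> J u v w = 0.
  move=> hH u v w Hvw; elim/gG: u => [u Gu|u u' hu hu'|u u' hu hu'].
  - exact: hH.
  - rewrite -[RHS]addr0 -{1}hu -hu' /J !(derivationD (dl _)) !(derivationD (dr _)).
    ring.
  (* Given antisymmetry, the Jacobiator is a derivation in its first argument. *)
  - transitivity (u * J u' v w + J u v w * u').
      2: by rewrite hu hu' mulr0 mul0r addr0.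
    rewrite /J !(dl _).2 !(dr _).2 !(derivationD (dr _)) !(dr _).2.
    rewrite (bC u' v) (bC u v) (derivationN (dr _)) (bC w u) (bC w u').
    rewrite !(derivationN (dr _)); ring.
suff: forall u v w, True -> J u v w = 0 by move=> h u v w; apply: h.
move=> u v w _.
(* The Jacobiator is invariant under rotation, so its three arguments are reduced to generators one
   at a time. *)
apply: (step (fun _ _ => True)) => // {}u {}v {}w Gu _.
rewrite Jrot; apply: (step (fun _ u => G u)) => // {Gu}u' {}v {}w Gu' Gw.
rewrite Jrot; apply: (step (fun u v => G u /\ G v)) => //.
by move=> {Gu' Gw}? ? ? Gu [Gv Gw]; apply: hJ.
Qed.

End Calculus.

Lemma generatedS (k : fieldType) (A : comAlgType k) (G H : A -> Prop) :
  (forall u, G u -> H u) -> generated G -> generated H.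
Proof. by move=> GH gG P hP; apply: gG => u /GH; apply: hP. Qed.

Lemma generatedT (k : fieldType) (A : comAlgType k) :
  generated (fun _ : A => True).
Proof. by move=> P hP _ _ u; apply: hP. Qed.

(** * Poisson Ore extensions *)

Section PolyDerivation.
Variables (A : comNzRingType) (delta : A -> {poly A}) (v : {poly A}).
Hypothesis deltaD : {morph delta : r s / r + s}.
Hypothesis deltaM : forall r s, delta (r * s) = delta r * s%:P + r%:P * delta s.

(** The derivation of A[t] that restricts to [delta] on A and sends ['X] to [v]. The values of
    [delta] lie in A[t] because those of {t, -} and {-, q} on A do. *)
Definition poly_der (p : {poly A}) : {poly A} :=
  \sum_(i < size p) delta p`_i * 'X^i + p^`() * v.

Let delta0 : delta 0 = 0.
Proof. by apply: (addrI (delta 0)); rewrite -deltaD !addr0. Qed.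

Let delta1 : delta 1 = 0.
Proof.
by apply: (addrI (delta 1)); have := deltaM 1 1; rewrite !mulr1 mul1r addr0.
Qed.

Let poly_derE N (p : {poly A}) : (size p <= N)%N ->
  poly_der p = \sum_(i < N) delta p`_i * 'X^i + p^`() * v.
Proof.
move=> pN; congr (_ + _); rewrite (big_ord_widen N (fun i => delta p`_i * 'X^i)) //.
rewrite [RHS](bigID (fun i : 'I_N => i < size p)%N) /= [X in _ + X]big1 ?addr0 //.
by move=> i; rewrite -leqNgt => ip; rewrite nth_default // delta0 mul0r.
Qed.

Lemma poly_derC r : poly_der r%:P = delta r.
Proof.
rewrite (poly_derE (size_polyC_leq1 r)) big_ord1 coefC eqxx expr0 mulr1.
by rewrite derivC mul0r addr0.
Qed.

Lemma poly_derX : poly_der 'X = v.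
Proof.
rewrite /poly_der size_polyX derivX mul1r !big_ord_recl big_ord0 !coefX /=.
by rewrite delta0 delta1 !mul0r !add0r.
Qed.

Lemma poly_derD : {morph poly_der : p q / p + q}.
Proof.
move=> p q; set N := maxn (size p) (size q).
rewrite (@poly_derE N p) ?leq_maxl // (@poly_derE N q) ?leq_maxr //.
rewrite (poly_derE (size_polyD p q)) derivD mulrDl addrACA -big_split /=.
by congr (_ + _); apply: eq_bigr => i _; rewrite coefD deltaD mulrDl.
Qed.

(** By Horner induction on [q], only multiplication by ['X] and by a constant has to be computed. *)
Lemma poly_derM (p q : {poly A}) : poly_der (p * q) = poly_der p * q + p * poly_der q.
Proof.
have MX (u : {poly A}) : poly_der (u * 'X) = poly_der u * 'X + u * v.
  rewrite (@poly_derE (size u).+1) ?(leq_trans (size_polyMleq _ _)) //; last first.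
    by rewrite size_polyX addn2.
  rewrite big_ord_recl coefMX delta0 mul0r add0r derivM derivX mulr1.
  rewrite /poly_der [in RHS]mulrDl mulr_suml mulrDl (mulrAC _ 'X) -!addrA.
  congr (_ + _); apply: eq_bigr => i _.
  by rewrite coefMX /= exprSr mulrA.
have MC (u : {poly A}) r : poly_der (u * r%:P) = poly_der u * r%:P + u * delta r.
  rewrite (@poly_derE (size u)); last first.
    by rewrite mulrC mul_polyC size_scale_leq.
  rewrite derivM derivC mulr0 addr0 /poly_der mulrDl mulr_suml.
  have -> : u * delta r = \sum_(i < size u) (u`_i)%:P * 'X^i * delta r.
    rewrite -mulr_suml -{1}[u]coefK poly_def; congr (_ * _).
    by apply: eq_bigr => i _; rewrite mul_polyC.
  rewrite [_ * v]mulrAC addrAC -big_split /=; congr (_ + _).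
  apply: eq_bigr => i _; rewrite coefMC deltaM; ring.
elim/poly_ind: q => [|q r IH].
  by rewrite mulr0 -[0 in LHS]polyC0 -[0 in RHS]polyC0 poly_derC delta0 !mulr0 addr0.
rewrite mulrDr mulrA poly_derD MX MC IH poly_derD MX poly_derC; ring.
Qed.

End PolyDerivation.

Section PolyGen.
Variables (k : fieldType) (A : comAlgType k).

Definition poly_gen (G : A -> Prop) (p : polyAlg A) : Prop :=
  (exists2 r, G r & p = r%:P) \/ p = 'X.

Lemma poly_generated (G : A -> Prop) : generated G -> generated (poly_gen G).
Proof.
move=> gG P PG PD PM.
have PC r : P r%:P.
  elim/gG: r => [r Gr|r s|r s]; first by apply: PG; left; exists r.
  - by rewrite polyCD; apply: PD.
  - by rewrite polyCM; apply: PM.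
elim/poly_ind => [|p r hp]; first exact: (PC 0).
by apply: PD (PC r); apply: PM hp (PG _ _); right.
Qed.

Lemma poly_algE c : c%:A = (c%:A)%:P :> polyAlg A.
Proof. by rewrite -[LHS]/((c%:A)%:P * 1 : {poly A}) mulr1. Qed.

Lemma poly_der_derivation (delta : A -> {poly A}) (v : {poly A}) :
  {morph delta : r s / r + s} ->
  (forall r s, delta (r * s) = delta r * s%:P + r%:P * delta s) ->
  (forall c : k, delta c%:A = 0) ->
  derivation (poly_der delta v : polyAlg A -> polyAlg A).
Proof.
move=> dD dM d0; apply: additive_derivation => [|p q|c].
- exact: poly_derD.
- exact: (poly_derM v dD dM).
- by rewrite poly_algE (poly_derC v dD).
Qed.

Lemma derivation_alg (d : A -> A) (c : k) : derivation d -> d c%:A = 0.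
Proof. by move=> dd; rewrite (derivationZ _ _ dd) (derivation1 dd) scaler0. Qed.

Lemma poly_derivation_exists (d : A -> A) (v : polyAlg A) : derivation d ->
  exists D : polyAlg A -> polyAlg A,
    [/\ derivation D, forall r, D r%:P = (d r)%:P & D 'X = v].
Proof.
move=> dd; pose delta r : {poly A} := (d r)%:P.
have deltaD : {morph delta : r s / r + s}.
  by move=> r s; rewrite /delta (derivationD dd) polyCD.
have deltaM r s : delta (r * s) = delta r * s%:P + r%:P * delta s.
  by rewrite /delta dd.2 polyCD !polyCM.
exists (poly_der delta v); split=> [|r|]; last exact: poly_derX.
- by apply: poly_der_derivation => // c; rewrite /delta derivation_alg.
- exact: poly_derC.
Qed.

End PolyGen.

(** * The bracket of a Poisson Ore extension *)

Section OreExtension.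
Variables (k : fieldType) (A : comAlgType k) (b : A -> A -> A) (d e : A -> A).
Hypothesis hb : poisson_bracket b.
Hypothesis hd : poisson_derivation b d.
Hypothesis he : poisson_skew_derivation b d e.

Let w r : {poly A} := (d r)%:P * 'X + (e r)%:P.

Let dd := hd.1.
Let de := he.1.

Let wD : {morph w : r s / r + s}.
Proof. by move=> r s; rewrite /w (derivationD dd) (derivationD de) !polyCD; ring. Qed.

Let wM r s : w (r * s) = w r * s%:P + r%:P * w s.
Proof. by rewrite /w dd.2 de.2 !polyCD !polyCM; ring. Qed.

Let w0 (c : k) : w c%:A = 0.
Proof. by rewrite /w !derivation_alg // polyC0 mul0r addr0. Qed.

(** [hamC r] and [hamX] are the future {r, -} and {t, -}, with [w r] in the role of {r, t}. *)
Let hamC r : {poly A} -> {poly A} := poly_der (fun s => (b r s)%:P) (w r).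
Let hamX : {poly A} -> {poly A} := poly_der (fun s => - w s) 0.

Let hamC_der r : derivation (hamC r : polyAlg A -> polyAlg A).
Proof.
apply: poly_der_derivation => [s t|s t|c].
- by rewrite (pb_addr hb) polyCD.
- by rewrite (pb_mulr hb) polyCD !polyCM.
- by rewrite derivation_alg //; apply: pb_derivation.
Qed.

Let hamX_der : derivation (hamX : polyAlg A -> polyAlg A).
Proof.
apply: poly_der_derivation => [s t|s t|c].
- by rewrite wD opprD.
- by rewrite wM opprD mulNr mulrN.
- by rewrite w0 oppr0.
Qed.

Let hamCC r s : hamC r s%:P = (b r s)%:P.
Proof. by apply: poly_derC => u v; rewrite (pb_addr hb) polyCD. Qed.

Let hamCX r : hamC r 'X = w r.
Proof.
apply: poly_derX => [s t|s t]; first by rewrite (pb_addr hb) polyCD.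
by rewrite (pb_mulr hb) polyCD !polyCM.
Qed.

Let hamXC r : hamX r%:P = - w r.
Proof. by apply: poly_derC => s t; rewrite wD opprD. Qed.

Let hamXX : hamX 'X = 0.
Proof.
apply: poly_derX => [s t|s t]; first by rewrite wD opprD.
by rewrite wM opprD mulNr mulrN.
Qed.

Let genT := poly_generated (@generatedT k A).

(** This and the next two facts say that r -> {r, q} is a derivation from A to A[t] killing scalars,
    which is what extending it to the first argument in A[t] requires. *)
Let hamCD q : {morph hamC^~ q : r s / r + s}.
Proof.
move=> r s; elim/genT: q => [_ [[t _ ->]|->]|p q hp hq|p q hp hq].
- by rewrite !hamCC (pb_addl hb) polyCD.
- by rewrite !hamCX wD.
- by rewrite !(derivationD (hamC_der _)) hp hq addrACA.
- by rewrite !(hamC_der _).2 hp hq; ring.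
Qed.

Let hamCM q r s : hamC (r * s) q = hamC r q * s%:P + r%:P * hamC s q.
Proof.
elim/genT: q => [_ [[t _ ->]|->]|p q hp hq|p q hp hq].
- by rewrite !hamCC (pb_mull hb) polyCD !polyCM.
- by rewrite !hamCX wM.
- by rewrite !(derivationD (hamC_der _)) hp hq; ring.
- by rewrite !(hamC_der _).2 hp hq; ring.
Qed.

Let hamC0 q (c : k) : hamC c%:A q = 0.
Proof.
elim/genT: q => [_ [[t _ ->]|->]|p q hp hq|p q hp hq].
- by rewrite hamCC (pb_antisym hb) derivation_alg ?oppr0 //; apply: pb_derivation.
- by rewrite hamCX w0.
- by rewrite (derivationD (hamC_der _)) hp hq addr0.
- by rewrite (hamC_der _).2 hp hq mul0r mulr0 addr0.
Qed.

(** For fixed [q] this is the extension of r -> {r, q} with value {t, q} at t. It is a derivation in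
    [p] by construction; in [q] this follows by induction on [p]. *)
Definition ore_bracket (p q : polyAlg A) : polyAlg A :=
  poly_der (fun r => hamC r q) (hamX q) p.

Let oreC r q : ore_bracket r%:P q = hamC r q.
Proof. exact: poly_derC. Qed.

Let oreX q : ore_bracket 'X q = hamX q.
Proof. exact: poly_derX. Qed.

Let ore_derl q : derivation (ore_bracket^~ q).
Proof. exact: poly_der_derivation. Qed.

Let ore_derr p : derivation (ore_bracket p).
Proof.
have [lin mul]: (forall c u v, ore_bracket p (c *: u + v) =
    c *: ore_bracket p u + ore_bracket p v) /\
    forall u v, ore_bracket p (u * v) = ore_bracket p u * v + u * ore_bracket p v.
  elim/genT: p => [_ [[r _ ->]|->]|p q [lp mp] [lq mq]|p q [lp mp] [lq mq]].
  - split=> [c u v|u v]; rewrite !oreC; [exact: (hamC_der r).1|exact: (hamC_der r).2].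
  - split=> [c u v|u v]; rewrite !oreX; [exact: hamX_der.1|exact: hamX_der.2].
  - split=> [c u v|u v]; rewrite !(derivationD (ore_derl _)).
      by rewrite lp lq addrACA -scalerDr.
    by rewrite mp mq; ring.
  - split=> [c u v|u v]; rewrite !(ore_derl _).2.
      by rewrite lp lq mulrDl mulrDr -scalerAl -scalerAr scalerDr addrACA.
    by rewrite mp mq; ring.
by split.
Qed.

Lemma ore_exists : exists b', poisson_ore b d e b'.
Proof.
exists ore_bracket.
have bCC r s : ore_bracket r%:P s%:P = (b r s)%:P by rewrite oreC hamCC.
have bCX r : ore_bracket r%:P 'X = w r by rewrite oreC hamCX.
have bXC r : ore_bracket 'X r%:P = - w r by rewrite oreX hamXC.
have bXX : ore_bracket 'X 'X = 0 by rewrite oreX hamXX.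
split=> //.
have brw r s : ore_bracket r%:P (w s) =
    (b r (d s))%:P * 'X + (d s)%:P * w r + (b r (e s))%:P.
  by rewrite (derivationD (ore_derr _)) (ore_derr _).2 !bCC bCX.
(* The Jacobi identity for r, s, t. Its coefficient at t says that [d] is a Poisson derivation, and
   its constant term is the skew identity for [e]. *)
have JCCX r s : ore_bracket r%:P (w s) - ore_bracket s%:P (w r) - w (b r s) = 0.
  rewrite !brw /w hd.2 he.2 (pb_antisym hb s (d r)) (pb_antisym hb s (e r)).
  rewrite !(polyCD, polyCN, polyCM); ring.
apply: (poisson_bracket_gen genT) => // [u v|u|u v t].
- case=> [[r _ ->]|->] [[s _ ->]|->].
  + by rewrite !bCC (pb_antisym hb) polyCN.
  + by rewrite bCX bXC opprK.
  + by rewrite bCX bXC.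
  + by rewrite bXX oppr0.
- by case=> [[r _ ->]|->] //; rewrite bCC (pb_alternating hb).
- have rN p q : ore_bracket p (- q) = - ore_bracket p q.
    exact: derivationN (ore_derr p) q.
  have r0 p : ore_bracket p 0 = 0 by apply: derivation0 (ore_derr p).
  case=> [[r _ ->]|->] [[s _ ->]|->] [[t' _ ->]|->];
    rewrite ?bXX ?r0 ?bCC ?bCX ?bXC ?rN ?addr0 ?add0r //.
  + by rewrite -!polyCD (pb_jacobi hb).
  + by rewrite -[RHS](JCCX t' r); ring.
  + by rewrite addNr.
  + by rewrite -[RHS](JCCX s t'); ring.
  + by rewrite addrN.
  + by rewrite addNr.
Qed.

End OreExtension.

(** * The bracket table *)

Section BracketTable.
Variables (k : fieldType) (n : nat) (R : comAlgType k) (br : R -> R -> R).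
Variables (d : 'I_n -> R -> R) (a : 'I_n -> R) (mu gamma : 'I_n -> 'I_n -> k).

(* The bracket table of A_mu(R, d, a), restricted to the x_i with [i < lx] and *)
(* the y_i with [i < ly], so that it covers all stages of both Ore extensions. *)
Record xy_rules (B : comAlgType k) (lx ly : nat) (c : R -> B) (x y : 'I_n -> B)
    (b : B -> B -> B) : Prop := {
  xy_cc : forall r s, b (c r) (c s) = c (br r s);
  xy_cx : forall r (i : 'I_n), (i < lx)%N -> b (c r) (x i) = c (d i r) * x i;
  xy_cy : forall r (i : 'I_n), (i < ly)%N -> b (c r) (y i) = - (c (d i r) * y i);
  xy_xy : forall i : 'I_n, (i < lx)%N -> (i < ly)%N -> b (x i) (y i) = - c (d i (a i));
  xy_xy_neq : forall (i j : 'I_n), (i < lx)%N -> (j < ly)%N -> i != j ->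
    b (x i) (y j) = - mu j i *: (x i * y j);
  xy_xx : forall (i j : 'I_n), (i < lx)%N -> (j < lx)%N -> i != j ->
    b (x i) (x j) = (gamma i j - mu i j) *: (x i * x j);
  xy_yy : forall (i j : 'I_n), (i < ly)%N -> (j < ly)%N -> i != j ->
    b (y i) (y j) = (mu j i - gamma i j) *: (y i * y j)
}.

Variant xy_gen (B : Type) (lx ly : nat) (c : R -> B) (x y : 'I_n -> B) :
    B -> Prop :=
  | XyC r : xy_gen lx ly c x y (c r)
  | XyX (i : 'I_n) of (i < lx)%N : xy_gen lx ly c x y (x i)
  | XyY (i : 'I_n) of (i < ly)%N : xy_gen lx ly c x y (y i).

(** Symmetry of [Q] leaves six kinds of pairs out of nine. *)
Lemma xy_gen_pairs (B : Type) lx ly (c : R -> B) (x y : 'I_n -> B)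
    (Q : B -> B -> Prop) :
  (forall u v, Q u v -> Q v u) -> (forall r s, Q (c r) (c s)) ->
  (forall r (i : 'I_n), (i < lx)%N -> Q (c r) (x i)) ->
  (forall r (i : 'I_n), (i < ly)%N -> Q (c r) (y i)) ->
  (forall (i j : 'I_n), (i < lx)%N -> (j < lx)%N -> Q (x i) (x j)) ->
  (forall (i j : 'I_n), (i < lx)%N -> (j < ly)%N -> Q (x i) (y j)) ->
  (forall (i j : 'I_n), (i < ly)%N -> (j < ly)%N -> Q (y i) (y j)) ->
  forall u v, xy_gen lx ly c x y u -> xy_gen lx ly c x y v -> Q u v.
Proof.
move=> Qs cc cx cy xx xy yy u v.
by case=> [r|i hi|i hi] [s|j hj|j hj]; auto.
Qed.

(** Both brackets are derivations in each argument, so agreement on pairs of generators suffices.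
    The pairs missing from the table are the diagonal ones, where both brackets vanish, and the
    reversed ones. *)
Lemma xy_bracket_unique (B : comAlgType k) lx ly (c : R -> B) (x y : 'I_n -> B)
    (b b' : B -> B -> B) :
  generated (xy_gen lx ly c x y) -> poisson_bracket b -> poisson_bracket b' ->
  xy_rules lx ly c x y b -> xy_rules lx ly c x y b' ->
  forall u v, b u v = b' u v.
Proof.
move=> gB hb hb' hr hr'.
have step (G H : B -> Prop) : generated G ->
    (forall u v, G u -> H v -> b u v = b' u v) ->
    forall u v, H v -> b u v = b' u v.
  move=> gG hG u v Hv; elim/gG: u => [u Gu|u u' hu hu'|u u' hu hu'].
  - exact: hG.
  - by rewrite (pb_addl hb) (pb_addl hb') hu hu'.
  - by rewrite (pb_mull hb) (pb_mull hb') hu hu'.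
have sym u v : b u v = b' u v -> b v u = b' v u.
  by rewrite (pb_antisym hb v) (pb_antisym hb' v) => ->.
suff H u v : True -> b u v = b' u v by move=> u v; apply: H.
apply: (step _ _ gB) => // {}u {}v Gu _; apply: (sym).
apply: (step _ _ gB) Gu => // {}u {}v; move: u v.
apply: xy_gen_pairs => [u v|r s|r i hi|r i hi|i j hi hj|i j hi hj|i j hi hj].
- exact: sym.
- by rewrite (xy_cc hr) (xy_cc hr').
- by rewrite (xy_cx hr) // (xy_cx hr').
- by rewrite (xy_cy hr) // (xy_cy hr').
- have [->|ij] := eqVneq i j.
    by rewrite (pb_alternating hb) (pb_alternating hb').
  by rewrite (xy_xx hr) // (xy_xx hr').
- have [ij|ij] := eqVneq i j; last by rewrite (xy_xy_neq hr) // (xy_xy_neq hr').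
  by subst j; rewrite (xy_xy hr) // (xy_xy hr').
- have [->|ij] := eqVneq i j.
    by rewrite (pb_alternating hb) (pb_alternating hb').
  by rewrite (xy_yy hr) // (xy_yy hr').
Qed.

(** Serves to carry the table of T to its quotient, and from there to A_mu. *)
Lemma xy_rules_map (A B : comAlgType k) (f : {lrmorphism A -> B}) lx ly
    (c : R -> A) (x y : 'I_n -> A) b (c' : R -> B) (x' y' : 'I_n -> B) b' :
  (forall r, f (c r) = c' r) -> (forall i, f (x i) = x' i) ->
  (forall i, f (y i) = y' i) -> (forall u v, b' (f u) (f v) = f (b u v)) ->
  xy_rules lx ly c x y b -> xy_rules lx ly c' x' y' b'.
Proof.
move=> fc fx fy fb hr; split=> *; rewrite -?(fc, fx, fy) fb.
- by rewrite (xy_cc hr).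
- by rewrite (xy_cx hr) // rmorphM.
- by rewrite (xy_cy hr) // rmorphN rmorphM.
- by rewrite (xy_xy hr) // rmorphN.
- by rewrite (xy_xy_neq hr) // linearZ rmorphM.
- by rewrite (xy_xx hr) // linearZ rmorphM.
- by rewrite (xy_yy hr) // linearZ rmorphM.
Qed.

(** * Compatibility of the derivations and of the relations with the table *)

Section Step.
Variables (B : comAlgType k) (lx ly : nat) (c : {lrmorphism R -> B}).
Variables (x y : 'I_n -> B) (b : B -> B -> B).
Hypothesis hb : poisson_bracket b.
Hypothesis hr : xy_rules lx ly c x y b.

Hypothesis hbr : poisson_bracket br.
Hypothesis hd : forall i, poisson_derivation br (d i).
Hypothesis hdC : forall i j r, d i (d j r) = d j (d i r).
Hypothesis ha_central : forall i, poisson_central br (a i).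
Hypothesis hda : forall i j, i != j -> d j (a i) = gamma i j *: a i.
Hypothesis hgm : forall i j, i != j -> gamma i j + gamma j i = mu i j + mu j i.

(** Turns scalars into elements of [B], so that [ring] can treat them. *)
Let scaleE (l : k) (u : B) : l *: u = in_alg B l * u.
Proof. by rewrite mulr_algl. Qed.

Let gammaE i j : i != j -> gamma i j = mu i j + mu j i - gamma j i.
Proof. by move=> /hgm <-; rewrite addrK. Qed.

(** Apply partial_i to {a_i, u} = 0. *)
Let da_central i u : br (d i (a i)) u = 0.
Proof.
have := (hd i).2 (a i) u; rewrite !ha_central addr0 => <-.
exact: derivation0 (hd i).1.
Qed.

Let dda i j : i != j -> d i (d j (a j)) = gamma j i *: d j (a j).
Proof. by move=> ij; rewrite hdC hda 1?eq_sym // (derivationZ _ _ (hd j).1). Qed.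

(** On a pair r, x_i the identity holds because the partial_i commute. On a pair of x's it holds
    because [D] scales both, and their bracket is a multiple of their product. *)
Lemma x_step (D : B -> B) (j : 'I_n) : generated (xy_gen lx 0 c x y) ->
  derivation D -> (forall r, D (c r) = c (d j r)) ->
  (forall i : 'I_n, (i < lx)%N -> D (x i) = (mu j i - gamma j i) *: x i) ->
  poisson_derivation b D.
Proof.
move=> gB hD Dc Dx; apply: (derivation_gen hb gB hD).
apply: xy_gen_pairs => // [u v uv|r s|r i hi|i i' hi hi'].
- by rewrite (pb_antisym hb) (derivationN hD) uv opprD addrC -!(pb_antisym hb).
- by rewrite !Dc !(xy_cc hr) Dc (hd j).2 linearD.
- rewrite Dc !Dx // (xy_cx hr) // hD.2 Dc Dx // (pb_scaler hb) !(xy_cx hr) //.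
  by rewrite (hdC i) !scaleE; ring.
- rewrite !Dx // (pb_scaler hb) (pb_scalel hb); have [->|ii'] := eqVneq i i'.
    by rewrite (pb_alternating hb) !scaler0 addr0 (derivation0 hD).
  rewrite (xy_xx hr) // (derivationZ _ _ hD) hD.2 !Dx // !scaleE; ring.
Qed.

(** Adjoining y_j is possible once all x's and the y_i with i < j are present. The map [phi] is
    diagonal on these variables and [psi] is supported on x_j, so few pairs need more than a
    comparison of scalars. *)
Lemma y_step (phi psi : B -> B) (j : 'I_n) : n = lx -> j = ly :> nat ->
  generated (xy_gen lx ly c x y) -> derivation phi -> derivation psi ->
  (forall r, phi (c r) = - c (d j r) /\ psi (c r) = 0) ->
  phi (x j) = 0 /\ psi (x j) = - c (d j (a j)) ->
  (forall i, i != j -> phi (x i) = - mu j i *: x i /\ psi (x i) = 0) ->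
  (forall i : 'I_n, (i < j)%N ->
     phi (y i) = (gamma j i - mu i j) *: y i /\ psi (y i) = 0) ->
  poisson_derivation b phi /\ poisson_skew_derivation b phi psi.
Proof.
move=> nx jl gB hphi hpsi pc [phixj psixj] px py.
have phic r := (pc r).1; have psic r := (pc r).2.
(* The weight of x_i under [phi]; the case i = j gets weight 0, which allows a uniform treatment. *)
pose p i := if i == j then 0 else - mu j i.
have phix i : phi (x i) = p i *: x i.
  by rewrite /p; case: eqVneq => [->|/px[]//]; rewrite phixj scale0r.
have psix i : i != j -> psi (x i) = 0 by move=> /px[].
have phiy (i : 'I_n) : (i < ly)%N -> phi (y i) = (gamma j i - mu i j) *: y i.
  by rewrite -jl => /py[].
have psiy (i : 'I_n) : (i < ly)%N -> psi (y i) = 0 by rewrite -jl => /py[].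
have neqj (i : 'I_n) : (i < ly)%N -> i != j.
  by rewrite -jl; apply: contraTneq => ->; rewrite ltnn.
have ltx (i : 'I_n) : (i < lx)%N by rewrite -nx.
split.
- apply: (derivation_gen hb gB hphi).
  apply: xy_gen_pairs => [u v uv|r s|r i _|r i hi|i i' _ _|i i' _ hi|i i' hi hi'].
  + by rewrite (pb_antisym hb) (derivationN hphi) uv opprD addrC -!(pb_antisym hb).
  + rewrite !phic (xy_cc hr) (pb_oppl hb) (pb_oppr hb) !(xy_cc hr) phic (hd j).2.
    by rewrite linearD opprD.
  + rewrite phic !phix (xy_cx hr) // hphi.2 phic phix (pb_scaler hb) (pb_oppl hb).
    by rewrite !(xy_cx hr) // (hdC i) !scaleE; ring.
  + rewrite phic !phiy // (xy_cy hr) // (derivationN hphi) hphi.2 phic phiy //.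
    by rewrite (pb_scaler hb) (pb_oppl hb) !(xy_cy hr) // (hdC i) !scaleE; ring.
  + rewrite !phix (pb_scaler hb) (pb_scalel hb); have [->|ii'] := eqVneq i i'.
      by rewrite (pb_alternating hb) !scaler0 addr0 (derivation0 hphi).
    by rewrite (xy_xx hr) // (derivationZ _ _ hphi) hphi.2 !phix !scaleE; ring.
  + rewrite phix phiy // (pb_scaler hb) (pb_scalel hb).
    have [ii'|ii'] := eqVneq i i'.
      subst i'; have ij := neqj _ hi.
      rewrite (xy_xy hr) // (derivationN hphi) phic dda 1?eq_sym // linearZ /=.
      (* The weights of x_i and y_i add up to - mu_ji + gamma_ji - mu_ij = - gamma_ij, the factor by
         which [phi] acts on the image of partial_i(a_i). *)
      by rewrite (gammaE ij) /p (negbTE ij) !scaleE; ring.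
    rewrite (xy_xy_neq hr) // (derivationZ _ _ hphi) hphi.2 phix phiy // !scaleE.
    by ring.
  + rewrite !phiy // (pb_scaler hb) (pb_scalel hb); have [->|ii'] := eqVneq i i'.
      by rewrite (pb_alternating hb) !scaler0 addr0 (derivation0 hphi).
    by rewrite (xy_yy hr) // (derivationZ _ _ hphi) hphi.2 !phiy // !scaleE; ring.
- apply: (skew_derivation_gen hb gB hphi hpsi).
  (* Among pairs of x's, only those containing x_j involve nonzero values of [psi]. *)
  have xx0 i : psi (b (x j) (x i)) = b (psi (x j)) (x i) + b (x j) (psi (x i)) -
      phi (x j) * psi (x i) + psi (x j) * phi (x i).
    have [->|ij] := eqVneq i j.
      rewrite (pb_alternating hb) (derivation0 hpsi) (pb_antisym hb (x j)) phixj; ring.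
    rewrite (psix i) // phixj psixj (px i ij).1 (pb_0r hb) (pb_oppl hb) (xy_cx hr) //.
    rewrite dda // linearZ /= (xy_xx hr) 1?eq_sym // (derivationZ _ _ hpsi) hpsi.2.
    by rewrite psixj psix // !scaleE; ring.
  apply: xy_gen_pairs => [u v|r s|r i _|r i hi|i i' _ _|i i' _ hi|i i' hi hi'].
  + exact: skew_at_sym.
  + by rewrite /skew_at (xy_cc hr) !psic (pb_0r hb) (pb_0l hb) mulr0 mul0r subr0 !addr0.
  + rewrite /skew_at (xy_cx hr) // hpsi.2 !psic (pb_0l hb) phic.
    have [->|ij] := eqVneq i j; last by rewrite psix // (pb_0r hb); ring.
    (* What remains is {r, partial_j(a_j)}, which vanishes by centrality. *)
    rewrite psixj (pb_oppr hb) (xy_cc hr) (pb_antisym hbr) da_central linearN linear0.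
    by ring.
  + rewrite /skew_at (xy_cy hr) // (derivationN hpsi) hpsi.2 !psic psiy //.
    by rewrite (pb_0l hb) (pb_0r hb); ring.
  + have [->|ij] := eqVneq i j; first exact: xx0.
    have [->|ij'] := eqVneq i' j; first by apply: skew_at_sym => //; apply: xx0.
    rewrite /skew_at !(psix i, psix i') // (pb_0l hb) (pb_0r hb).
    have [->|ii'] := eqVneq i i'.
      by rewrite (pb_alternating hb) (derivation0 hpsi); ring.
    by rewrite (xy_xx hr) // (derivationZ _ _ hpsi) hpsi.2 !psix // !scaleE; ring.
  + have i'j := neqj _ hi; rewrite /skew_at (psiy i') // (pb_0r hb).
    have [ii'|ii'] := eqVneq i i'.
      subst i'; rewrite (xy_xy hr) // (derivationN hpsi) psic psix // (pb_0l hb).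
      by ring.
    rewrite (xy_xy_neq hr) // (derivationZ _ _ hpsi) hpsi.2 (psiy i') //.
    have [eij|ij] := eqVneq i j; last by rewrite psix // (pb_0l hb) !scaleE; ring.
    subst i; rewrite psixj phiy // (pb_oppl hb) (xy_cy hr) // dda // linearZ /=.
    by rewrite !scaleE; ring.
  + rewrite /skew_at !psiy // (pb_0l hb) (pb_0r hb); have [->|ii'] := eqVneq i i'.
      by rewrite (pb_alternating hb) (derivation0 hpsi); ring.
    by rewrite (xy_yy hr) // (derivationZ _ _ hpsi) hpsi.2 !psiy // !scaleE; ring.
Qed.

(** Bracketing with the relation is a derivation, so generators suffice. It kills the image of R,
    x_i and y_i; on the other x_j and y_j the scalars mu cancel and only gamma_ij survives. *)
Lemma rel_poisson (i : 'I_n) v : n = lx -> n = ly ->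
  generated (xy_gen lx ly c x y) ->
  exists h, b (y i * x i - c (a i)) v = h * (y i * x i - c (a i)).
Proof.
move=> nx ny gB.
have ltx (j : 'I_n) : (j < lx)%N by rewrite -nx.
have lty (j : 'I_n) : (j < ly)%N by rewrite -ny.
set g := _ - _; elim/gB: v => [_ [r|j _|j _]|u v [p hp] [q hq]|u v [p hp] [q hq]].
- exists 0; rewrite mul0r /g (pb_addl hb) (pb_mull hb) (pb_oppl hb) (xy_cc hr).
  rewrite ha_central (pb_antisym hb (y i)) (pb_antisym hb (x i)) (xy_cx hr) //.
  by rewrite (xy_cy hr) // linear0; ring.
- rewrite /g (pb_addl hb) (pb_mull hb) (pb_oppl hb) (xy_cx hr) // (pb_antisym hb (y i)).
  have [eij|ij] := eqVneq i j.
    subst j; exists 0; rewrite (xy_xy hr) // (pb_alternating hb); ring.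
  (* Both {y_i x_i, x_j} and {a_i, x_j} are the left entry times gamma_ij x_j. *)
  exists (gamma i j *: x j); rewrite hda // linearZ /=.
  rewrite (xy_xy_neq hr) 1?eq_sym // (xy_xx hr) // !scaleE; ring.
- rewrite /g (pb_addl hb) (pb_mull hb) (pb_oppl hb) (xy_cy hr) //.
  have [eij|ij] := eqVneq i j.
    subst j; exists 0; rewrite (xy_xy hr) // (pb_alternating hb); ring.
  exists (- gamma i j *: y j); rewrite hda // linearZ /=.
  rewrite (xy_xy_neq hr) // (xy_yy hr) // !scaleE; ring.
- by exists (p + q); rewrite (pb_addr hb) hp hq mulrDl.
- by exists (p * v + u * q); rewrite (pb_mulr hb) hp hq; ring.
Qed.

End Step.
End BracketTable.

(** * The iterated extensions T_0 and T *)

Lemma polyC_scale (k : fieldType) (A : comAlgType k) c (u : A) :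
  (c *: u)%:P = c *: (u%:P : polyAlg A).
Proof. by rewrite -mulr_algl polyCM. Qed.

(* [po_var] and [polyCM] with the products taken in [polyAlg A] rather than in  *)
(* the convertible [{poly A}], so that scalars of k can be moved across them.  *)
Lemma ore_var (k : fieldType) (A : comAlgType k) (b : A -> A -> A) d e b' r :
  poisson_ore b d e b' ->
  b' r%:P 'X = ((d r)%:P : polyAlg A) * ('X : polyAlg A) + (e r)%:P.
Proof. by move=> /po_var ->. Qed.

Lemma polyAlgCM (k : fieldType) (A : comAlgType k) (u v : A) :
  (u * v)%:P = (u%:P : polyAlg A) * (v%:P : polyAlg A).
Proof. exact: polyCM. Qed.

Section IteratedPoly.
Variables (k : fieldType) (A : comAlgType k).

Fact iconst_linear m : linear (@iconst k A m).
Proof.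
by elim: m => [|m IH] c u v //=; rewrite IH polyCD polyC_scale.
Qed.

Fact iconst_monoid_morphism m : monoid_morphism (@iconst k A m).
Proof.
elim: m => [|m [IH1 IHM]] //; split=> [|u v] /=; first by rewrite IH1.
by rewrite IHM polyCM.
Qed.

HB.instance Definition _ (m : nat) :=
  GRing.isLinear.Build k A (ipoly A m) *:%R (@iconst k A m) (@iconst_linear m).
HB.instance Definition _ (m : nat) :=
  GRing.isMonoidMorphism.Build A (ipoly A m) (@iconst k A m)
    (@iconst_monoid_morphism m).

Definition ipoly_gen (G : A -> Prop) m (u : ipoly A m) : Prop :=
  (exists2 r, G r & u = iconst m r) \/ (exists2 i, (i < m)%N & u = ivar A m i).

Lemma ivarS_eq m : ivar A m.+1 m = 'X.
Proof. by rewrite /= eqxx. Qed.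

Lemma ivarS_lt m i : (i < m)%N -> ivar A m.+1 i = (ivar A m i)%:P.
Proof. by move=> im; rewrite /= ltn_eqF. Qed.

Lemma ipoly_generated (G : A -> Prop) m : generated G -> generated (@ipoly_gen G m).
Proof.
move=> gG; elim: m => [|m /poly_generated gm].
  by apply: generatedS gG => u Gu; left; exists u.
apply: generatedS gm => u [[_ [[r Gr ->]|[i im ->]] ->]|->].
- by left; exists r.
- by right; exists i; [exact: ltnW | rewrite ivarS_lt].
- by right; exists m; rewrite ?ivarS_eq.
Qed.

(** The affine shape of the values covers all cases needed: diagonal for partial_j and phi_j,
    constant for psi_j. *)
Lemma ipoly_derivation_exists m (d0 : A -> A) (cf : nat -> k) (w : nat -> A) :
  derivation d0 -> exists D : ipoly A m -> ipoly A m,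
  [/\ derivation D, forall r, D (iconst m r) = iconst m (d0 r)
    & forall i, (i < m)%N -> D (ivar A m i) = cf i *: ivar A m i + iconst m (w i)].
Proof.
move=> hd0; elim: m => [|m [D [hD DC DX]]]; first by exists d0.
have [D' [hD' D'C D'X]] :=
  poly_derivation_exists (cf m *: ('X : polyAlg _) + (iconst m (w m))%:P) hD.
exists D'; split=> // [r|i]; first by rewrite /= D'C DC.
rewrite ltnS leq_eqVlt => /predU1P[->|im]; first by rewrite ivarS_eq D'X.
by rewrite ivarS_lt // D'C DX // polyCD polyC_scale.
Qed.

End IteratedPoly.

(** Variables of [ipoly] are numbered by [nat], families by ['I_n]; the default is only a filler for
    indices from n on. *)
Definition extend_ord (T : Type) (n : nat) (x0 : T) (f : 'I_n -> T) (i : nat) : T :=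
  if insub i is Some j then f j else x0.

Lemma extend_ordE T n (x0 : T) (f : 'I_n -> T) (i : 'I_n) : extend_ord x0 f i = f i.
Proof. by rewrite /extend_ord valK. Qed.

Section OreTowers.
Variables (k : fieldType) (n : nat) (R : comAlgType k) (br : R -> R -> R).
Variables (d : 'I_n -> R -> R) (a : 'I_n -> R) (mu gamma : 'I_n -> 'I_n -> k).
Hypothesis hbr : poisson_bracket br.
Hypothesis hd : forall i, poisson_derivation br (d i).
Hypothesis hdC : forall i j r, d i (d j r) = d j (d i r).
Hypothesis ha_central : forall i, poisson_central br (a i).
Hypothesis hda : forall i j, i != j -> d j (a i) = gamma i j *: a i.
Hypothesis hgm : forall i j, i != j -> gamma i j + gamma j i = mu i j + mu j i.

(** Equates the weight used to extend partial_j with the entry {x_i, x_j} of the table; [yy_skew]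
    does the same for the y's. *)
Let xx_skew i j : i != j -> mu j i - gamma j i = gamma i j - mu i j.
Proof.
move=> ij; have -> : mu j i = gamma i j + gamma j i - mu i j; last by ring.
by rewrite hgm //; ring.
Qed.

Let yy_skew i j : i != j -> gamma j i - mu i j = mu j i - gamma i j.
Proof.
move=> ij; have -> : mu j i = gamma i j + gamma j i - mu i j; last by ring.
by rewrite hgm //; ring.
Qed.

Let x0 l (i : 'I_n) : ipoly R l := ivar R l i.

Lemma oreT0_generated l : (l <= n)%N -> generated
  (xy_gen l 0 (@iconst k R l) (x0 l) (fun=> 0)).
Proof.
move=> ln; apply: (generatedS _ (ipoly_generated (generatedT (A := R)))) => u.
case=> [[r _ ->]|[i il ->]]; first exact: XyC.
exact: (XyX _ _ (x0 l) _ (i := Ordinal (leq_trans il ln))).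
Qed.

Lemma ltn_ordS (l : nat) (ln : (l < n)%N) (i : 'I_n) :
  (i < l.+1)%N -> i = Ordinal ln \/ (i < l)%N.
Proof. by rewrite ltnS leq_eqVlt => /predU1P[il|]; [left; apply: val_inj|right]. Qed.

(** Proved for every bracket satisfying the tower conditions, as the final comparison requires. The
    entries involving the newest variable are read off [po_var]. No y exists yet, so [fun=> 0] is a
    placeholder. *)
Lemma oreT0_rules l (b : ipoly R l -> ipoly R l -> ipoly R l) : (l <= n)%N ->
  iterated_ore br (oreT0_step d mu gamma) b ->
  poisson_bracket b /\
  xy_rules br d a mu gamma l 0 (@iconst k R l) (x0 l) (fun=> 0) b.
Proof.
elim: l b => [|l IH] b ln /=; first by move->; split.
move=> [b' [D [E [/(IH _ (ltnW ln)) [hb' hr'] hstep hore]]]].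
have hb := po_bracket hore; split=> //.
pose j := Ordinal ln; have [DC DX E0] := hstep j erefl.
have xj : x0 l.+1 j = 'X by exact: ivarS_eq.
have xl (i : 'I_n) : (i < l)%N -> x0 l.+1 i = (x0 l i)%:P by exact: ivarS_lt.
have jx (i : 'I_n) : (i < l)%N -> b (x0 l.+1 i) (x0 l.+1 j) =
    (gamma i j - mu i j) *: (x0 l.+1 i * x0 l.+1 j).
  move=> il; rewrite xj xl // (ore_var _ hore) E0 DX // addr0.
  by rewrite polyC_scale -scalerAl xx_skew // -val_eqE ltn_eqF.
split=> // [r s|r i /(ltn_ordS ln)[->|il]|].
- by rewrite /= (po_const hore) (xy_cc hr').
- by rewrite xj /= (ore_var _ hore) E0 DC polyC0 addr0.
- by rewrite xl //= (po_const hore) (xy_cx hr') // polyAlgCM.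
move=> i i' /(ltn_ordS ln)[eij|il] /(ltn_ordS ln)[eij'|il'] ii'.
- by rewrite eij eij' eqxx in ii'.
- rewrite eij in ii' *.
  by rewrite (pb_antisym hb) jx // -scaleNr opprB mulrC xx_skew.
- by rewrite eij' jx.
- by rewrite !xl // (po_const hore) (xy_xx hr') // polyC_scale polyAlgCM.
Qed.

Lemma oreT0_exists l : (l <= n)%N ->
  exists b : ipoly R l -> ipoly R l -> ipoly R l,
    iterated_ore br (oreT0_step d mu gamma) b.
Proof.
elim: l => [|l IH] ln; first by exists br.
have [b' hb'] := IH (ltnW ln); have [pb' rb'] := oreT0_rules (ltnW ln) hb'.
pose j := Ordinal ln.
have [D [hD DC DX]] := ipoly_derivation_exists l
  (extend_ord 0 (fun i => mu j i - gamma j i)) (fun=> 0) (hd j).1.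
have Dx (i : 'I_n) : (i < l)%N -> D (ivar R l i) = (mu j i - gamma j i) *: ivar R l i.
  by move=> il; rewrite DX // extend_ordE raddf0 addr0.
have pD := x_step pb' rb' hd hdC (oreT0_generated (ltnW ln)) hD DC Dx.
have pE : poisson_skew_derivation b' D (fun=> 0).
  split; first exact: derivation_null.
  by move=> u v; rewrite (pb_0l pb') (pb_0r pb') mulr0 mul0r subr0 !addr0.
have [b hore] := ore_exists pb' pD pE.
exists b, b', D, (fun=> 0); split=> // j' j'l.
by have -> : j' = j by apply: val_inj.
Qed.

Section OverT0.
Variable b0 : ipoly R n -> ipoly R n -> ipoly R n.
Hypothesis hb0 : poisson_bracket b0.
Hypothesis hr0 : xy_rules br d a mu gamma n 0 (@iconst k R n)
  (x0 n) (fun=> 0) b0.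

Let c l : {lrmorphism R -> ipoly (ipoly R n) l} :=
  @iconst k (ipoly R n) l \o @iconst k R n.
Let x l (i : 'I_n) : ipoly (ipoly R n) l := iconst l (ivar R n i).
Let y l (i : 'I_n) : ipoly (ipoly R n) l := ivar (ipoly R n) l i.

Lemma oreT_generated l : (l <= n)%N -> generated (xy_gen n l (c l) (x l) (y l)).
Proof.
move=> ln; apply: (generatedS _ (ipoly_generated (oreT0_generated (leqnn n)))) => u.
case=> [[_ [r|i _|i //] ->]|[i il ->]]; first exact: XyC.
  exact: (XyX _ _ (x l)).
exact: (XyY _ _ _ (y l) (i := Ordinal (leq_trans il ln))).
Qed.

Lemma oreT_rules l b : (l <= n)%N ->
  iterated_ore b0 (oreT_step d a mu gamma) b ->
  poisson_bracket b /\ xy_rules br d a mu gamma n l (c l) (x l) (y l) b.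
Proof.
elim: l b => [|l IH] b ln /=; first by move->; split.
move=> [b' [D [E [/(IH _ (ltnW ln)) [hb' hr'] hstep hore]]]].
have hb := po_bracket hore; split=> //.
pose j := Ordinal ln; have [DEC [Dx Ex] DEX DEY] := hstep j erefl.
have yj : y l.+1 j = 'X by exact: ivarS_eq.
have yl (i : 'I_n) : (i < l)%N -> y l.+1 i = (y l i)%:P by exact: ivarS_lt.
have xl i : x l.+1 i = (x l i)%:P by [].
have cl r : c l.+1 r = (c l r)%:P by [].
have jy (i : 'I_n) : (i < l)%N -> b (y l.+1 i) (y l.+1 j) =
    (mu j i - gamma i j) *: (y l.+1 i * y l.+1 j).
  move=> il; rewrite yj yl // (ore_var _ hore) (DEY i il).1 (DEY i il).2.
  by rewrite polyC0 addr0 polyC_scale -scalerAl yy_skew // -val_eqE /= ltn_eqF.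
split.
- by move=> r s; rewrite !cl (po_const hore) (xy_cc hr').
- by move=> r i _; rewrite !cl !xl (po_const hore) (xy_cx hr') // polyAlgCM.
- move=> r i /(ltn_ordS ln)[->|il].
    rewrite yj !cl (ore_var _ hore) (DEC r).1 (DEC r).2.
    by rewrite polyC0 addr0 polyCN mulNr.
  by rewrite yl // !cl (po_const hore) (xy_cy hr') // polyCN polyAlgCM.
- move=> i _ /(ltn_ordS ln)[->|il].
    by rewrite yj xl (ore_var _ hore) Dx Ex polyC0 mul0r add0r polyCN.
  by rewrite yl // xl (po_const hore) (xy_xy hr') // polyCN.
- move=> i i' _ /(ltn_ordS ln)[->|il] ii'.
    rewrite yj xl (ore_var _ hore) (DEX i ii').1 (DEX i ii').2.
    by rewrite polyC0 addr0 polyC_scale -scalerAl.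
  by rewrite yl // xl (po_const hore) (xy_xy_neq hr') // polyC_scale polyAlgCM.
- move=> i i' _ _ ii'.
  by rewrite !xl (po_const hore) (xy_xx hr') // polyC_scale polyAlgCM.
move=> i i' /(ltn_ordS ln)[ei|il] /(ltn_ordS ln)[ei'|il'] ii'.
- by rewrite ei ei' eqxx in ii'.
- rewrite ei in ii' *.
  by rewrite (pb_antisym hb) jy // -scaleNr opprB mulrC yy_skew.
- by rewrite ei' jy.
- by rewrite !yl // (po_const hore) (xy_yy hr') // polyC_scale polyAlgCM.
Qed.

Lemma oreT_stage_exists l : (l <= n)%N ->
  exists b : ipoly (ipoly R n) l -> ipoly (ipoly R n) l -> ipoly (ipoly R n) l,
    iterated_ore b0 (oreT_step d a mu gamma) b.
Proof.
elim: l => [|l IH] ln; first by exists b0.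
have [b' hb'] := IH (ltnW ln); have [pb' rb'] := oreT_rules (ltnW ln) hb'.
pose j := Ordinal ln.
(* Both [phi] and [psi] are built in two rounds: from R to T_0 across the x's, then across the y's
   already adjoined. *)
have [phi0 [hphi0 phi0C phi0X]] := ipoly_derivation_exists n
  (extend_ord 0 (fun i => if i == j then 0 else - mu j i)) (fun=> 0)
  (derivation_opp (hd j).1).
have [phi [hphi phiC phiY]] := ipoly_derivation_exists l
  (extend_ord 0 (fun i => gamma j i - mu i j)) (fun=> 0) hphi0.
have [psi0 [hpsi0 psi0C psi0X]] := ipoly_derivation_exists n (fun=> 0)
  (extend_ord 0 (fun i => if i == j then - d j (a j) else 0)) (@derivation_null k R).
have [psi [hpsi psiC psiY]] := ipoly_derivation_exists l (fun=> 0) (fun=> 0) hpsi0.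
have hstep : oreT_step d a mu gamma phi psi.
  move=> j' j'l; have {j' j'l} -> : j' = j by apply: val_inj.
  split=> [r||i ij|i il].
  - by rewrite phiC phi0C psiC psi0C !raddf0 !raddfN.
  - rewrite phiC phi0X // psiC psi0X // !extend_ordE eqxx !scale0r !raddf0 !add0r.
    by rewrite !raddfN raddf0.
  - rewrite phiC phi0X // psiC psi0X // !extend_ordE (negbTE ij).
    by rewrite scale0r !raddf0 !addr0 linearZ raddf0.
  - by rewrite phiY // psiY // extend_ordE !raddf0 scale0r !addr0.
have [px py pz pt] := hstep j erefl.
have [pphi ppsi] := y_step pb' rb' hbr hd hdC ha_central hda hgm erefl
  (erefl : j = l :> nat) (oreT_generated (ltnW ln)) hphi hpsi px py pz pt.
have [b hore] := ore_exists pb' pphi ppsi.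
by exists b, b', phi, psi.
Qed.

End OverT0.
End OreTowers.

(** * Quotients and universal properties *)

(** Used to promote evaluation morphisms of polynomial rings to algebra maps. *)
Lemma lrmorphism_of (k : fieldType) (A B : comAlgType k) (f : {rmorphism A -> B}) :
  (forall c : k, f c%:A = c%:A) -> exists h : {lrmorphism A -> B}, h =1 f.
Proof.
move=> fA; have fZ : scalable f by move=> c u; rewrite -mulr_algl rmorphM fA mulr_algl.
pose S := GRing.isScalable.Build k A B *:%R f fZ.
by exists (HB.pack_for {lrmorphism A -> B} (f : A -> B) f S).
Qed.

Lemma lrmorphism_alg (k : fieldType) (A B : comAlgType k) (f : {lrmorphism A -> B})
  (c : k) : f c%:A = c%:A.
Proof. by rewrite linearZ rmorph1. Qed.

Section Quotients.
Variables (k : fieldType) (A : comAlgType k) (m : nat) (g : 'I_m -> A).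
Variable gP : ~ in_ideal g 1.

Lemma quot_pi_eq u v : quot_pi gP u = quot_pi gP v <-> in_ideal g (u - v).
Proof.
have E := Quotient.idealrBE (gideal gP : idealr A) u v.
split=> [/eqP|] H; last by apply/eqP; rewrite -[_ == _]E; apply/asboolP.
by move: H; rewrite -[_ == _]E => /asboolP.
Qed.

Lemma quot_pi_eq0 u : quot_pi gP u = 0 <-> in_ideal g u.
Proof. by have := quot_pi_eq u 0; rewrite subr0 raddf0. Qed.

Lemma quot_pi_gen i : quot_pi gP (g i) = 0.
Proof.
apply/quot_pi_eq0; exists (fun j => (j == i)%:R).
by rewrite (bigD1 i) //= eqxx mul1r big1 ?addr0 // => j /negbTE->; rewrite mul0r.
Qed.

Lemma quot_piZ c u : quot_pi gP (c *: u) = c *: quot_pi gP u.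
Proof. by rewrite -mulr_algl rmorphM. Qed.

HB.instance Definition _ :=
  GRing.isScalable.Build k A (quotAlg gP) *:%R (quot_pi gP) quot_piZ.

Lemma quot_pi_surj (z : quotAlg gP) : exists u, z = quot_pi gP u.
Proof.
by exists (generic_quotient.repr z); rewrite /quot_pi generic_quotient.reprK.
Qed.

Lemma quot_generated (G : A -> Prop) : generated G ->
  generated (fun z : quotAlg gP => exists2 u, G u & z = quot_pi gP u).
Proof.
move=> gG P PG PD PM z; have [u ->] := quot_pi_surj z.
elim/gG: u => [u Gu|u v hu hv|u v hu hv]; first by apply: PG; exists u.
- by rewrite rmorphD; apply: PD.
- by rewrite rmorphM; apply: PM.
Qed.

Lemma quot_hom (B : comAlgType k) (f : {lrmorphism A -> B}) :
  (forall i, f (g i) = 0) ->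
  exists h : {lrmorphism quotAlg gP -> B}, forall u, h (quot_pi gP u) = f u.
Proof.
(* Defined through chosen representatives; the choice is immaterial because [f] kills the ideal. *)
move=> fg; pose h (z : quotAlg gP) := f (projT1 (cid (quot_pi_surj z))).
have hE u : h (quot_pi gP u) = f u.
  rewrite /h; case: cid => v /= /quot_pi_eq [c /(congr1 f)].
  rewrite rmorphB rmorph_sum big1 => [/subr0_eq//|i _].
  by rewrite rmorphM /= fg mulr0.
have hB : zmod_morphism h.
  move=> z z'; have [u ->] := quot_pi_surj z; have [u' ->] := quot_pi_surj z'.
  by rewrite -rmorphB !hE rmorphB.
have hM : monoid_morphism h.
  split=> [|z z']; first by rewrite -(rmorph1 (quot_pi gP)) hE rmorph1.
  have [u ->] := quot_pi_surj z; have [u' ->] := quot_pi_surj z'.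
  by rewrite -rmorphM !hE rmorphM.
pose hr := HB.pack_for {rmorphism quotAlg gP -> B} h
  (GRing.isZmodMorphism.Build (quotAlg gP) B h hB)
  (GRing.isMonoidMorphism.Build (quotAlg gP) B h hM).
have [|h' h'E] := @lrmorphism_of k _ _ hr; last by exists h' => u; rewrite h'E.
move=> c; rewrite -(rmorph1 (quot_pi gP)) -quot_piZ /= hE.
exact: lrmorphism_alg.
Qed.

(** The ideal is Poisson, since {c g_i, v} = {c, v} g_i + c {g_i, v}; hence the bracket of
    representatives is well defined modulo it. *)
Lemma quotient_bracket_exists (b : A -> A -> A) : poisson_bracket b ->
  (forall i v, exists h, b (g i) v = h * g i) ->
  exists bq, quotient_bracket (gP := gP) b bq.
Proof.
move=> hb hg; have pb_ideal u v : in_ideal g u -> quot_pi gP (b u v) = 0.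
  move=> [c ->]; elim/big_rec: _ => [|i u' _ IH]; first by rewrite (pb_0l hb) raddf0.
  rewrite (pb_addl hb) (pb_mull hb) !rmorphD !rmorphM /= IH quot_pi_gen.
  by have [h ->] := hg i v; rewrite rmorphM /= quot_pi_gen !mulr0 !addr0.
have pb_eql u u' v : quot_pi gP u = quot_pi gP u' ->
    quot_pi gP (b u v) = quot_pi gP (b u' v).
  move=> /quot_pi_eq /(pb_ideal _ v) /eqP.
  by rewrite (pb_addl hb) (pb_oppl hb) rmorphB subr_eq0 => /eqP.
have pb_eq u u' v v' : quot_pi gP u = quot_pi gP u' -> quot_pi gP v = quot_pi gP v' ->
    quot_pi gP (b u v) = quot_pi gP (b u' v').
  move=> /pb_eql -> hv; rewrite (pb_antisym hb) (pb_antisym hb u') !rmorphN.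
  by congr (- _); apply: pb_eql.
pose rep (z : quotAlg gP) := projT1 (cid (quot_pi_surj z)).
have repK z : quot_pi gP (rep z) = z by rewrite /rep; case: cid.
pose bq z z' := quot_pi gP (b (rep z) (rep z')).
have bqE u v : bq (quot_pi gP u) (quot_pi gP v) = quot_pi gP (b u v).
  by apply: pb_eq; apply: repK.
have lift (P : quotAlg gP -> Prop) : (forall u, P (quot_pi gP u)) -> forall z, P z.
  by move=> hP z; have [u ->] := quot_pi_surj z.
exists bq; split=> //; split.
- elim/lift=> w c; elim/lift=> u; elim/lift=> v.
  by rewrite -quot_piZ -rmorphD !bqE -quot_piZ -rmorphD (pb_linearl hb).
- by elim/lift=> u; rewrite bqE (pb_alternating hb) rmorph0.
- elim/lift=> u; elim/lift=> v; elim/lift=> w.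
  by rewrite !bqE -!rmorphD (pb_jacobi hb) rmorph0.
- elim/lift=> u; split.
    move=> c; elim/lift=> v; elim/lift=> w.
    rewrite -quot_piZ -rmorphD !bqE -quot_piZ -rmorphD.
    by rewrite (pb_addr hb) (pb_scaler hb).
  elim/lift=> v; elim/lift=> w.
  by rewrite -rmorphM !bqE -!rmorphM -rmorphD (pb_mulr hb).
Qed.

End Quotients.

(** * Universal properties of polynomial algebras *)

Section PolyHom.
Variables (k : fieldType) (A B : comAlgType k).

Lemma ipoly_hom m (h : {lrmorphism A -> B}) (v : nat -> B) :
  exists f : {lrmorphism ipoly A m -> B},
    (forall r, f (iconst m r) = h r) /\ (forall i, (i < m)%N -> f (ivar A m i) = v i).
Proof.
elim: m => [|m [f [fC fX]]]; first by exists h.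
have cfv : commr_rmorph f (v m) by move=> x; apply: mulrC.
have [|f' f'E] := @lrmorphism_of k (ipoly A m.+1) B
    (horner_morph cfv : {rmorphism polyAlg (ipoly A m) -> B}).
  by move=> c; rewrite poly_algE /= horner_morphC; apply: lrmorphism_alg.
exists f'; split=> [r|i]; first by rewrite f'E /= horner_morphC; apply: fC.
rewrite ltnS leq_eqVlt => /predU1P[->|im].
  by rewrite ivarS_eq f'E /= horner_morphX.
by rewrite ivarS_lt // f'E /= horner_morphC; apply: fX.
Qed.

Import mpoly.

Lemma mpoly_algE m (c : k) : c%:A = (c%:A)%:MP_[m] :> mpolyAlg A m.
Proof. by rewrite -[LHS]/((c%:A)%:MP_[m] * 1) mulr1. Qed.

Lemma mpolyC_hom m : exists h : {lrmorphism A -> mpolyAlg A m}, forall r, h r = r%:MP.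
Proof.
have [|h hE] := @lrmorphism_of k A (mpolyAlg A m)
    (@mpolyC m A : {rmorphism A -> mpolyAlg A m}); last by exists h.
by move=> c; rewrite mpoly_algE.
Qed.

Lemma mpoly_hom m (h : {lrmorphism A -> B}) (v : 'I_m -> B) :
  exists f : {lrmorphism mpolyAlg A m -> B},
    (forall r, f r%:MP = h r) /\ (forall i, f 'X_i = v i).
Proof.
have [|f' f'E] := @lrmorphism_of k (mpolyAlg A m) B
    (mmap h v : {rmorphism mpolyAlg A m -> B}).
  move=> c; rewrite mpoly_algE /= mmapC.
  exact: lrmorphism_alg.
exists f'; split=> [r|i]; first by rewrite f'E /= mmapC.
by rewrite f'E /= mmapX mmap1U.
Qed.

Lemma mpoly_generated m : generated (fun u : mpolyAlg A m =>
  (exists r, u = r%:MP) \/ (exists i, u = 'X_i)).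
Proof.
move=> P PG PD PM; have PC r : P r%:MP by apply: PG; left; exists r.
elim/mpolyind => [|c u p _ _ hp]; first exact: (PC 0).
apply: (PD _ _ _ hp); rewrite -mul_mpolyC; apply: (PM _ _ (PC c)).
rewrite mpolyXE_id; elim/big_rec: _ => [|i q _ hq]; first exact: (PC 1).
apply: (PM _ _ _ hq); elim: (u i) => [|e IH]; first exact: (PC 1).
by rewrite exprS; apply: (PM _ _ _ IH); apply: PG; right; exists i.
Qed.

End PolyHom.

Lemma generated_id (k : fieldType) (A : comAlgType k) (G : A -> Prop)
  (f : {lrmorphism A -> A}) : generated G -> (forall u, G u -> f u = u) -> f =1 id.
Proof.
move=> gG fG; elim/gG => [//|u v hu hv|u v hu hv];
by rewrite ?rmorphD ?rmorphM /= hu hv.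
Qed.

Lemma transport_poisson (k : fieldType) (A B : comAlgType k)
    (f : {lrmorphism A -> B}) (g : {lrmorphism B -> A}) (b : B -> B -> B) :
  cancel f g -> cancel g f -> poisson_bracket b ->
  poisson_bracket (fun u v => g (b (f u) (f v))).
Proof.
move=> fK gK hb; split.
- by move=> w c u v; rewrite linearP (pb_linearl hb) linearP.
- by move=> u; rewrite (pb_alternating hb) rmorph0.
- by move=> u v w; rewrite !gK -!rmorphD (pb_jacobi hb) rmorph0.
- move=> u; split=> [c v w|v w].
    by rewrite linearP (pb_derivation hb _).1 linearP.
  by rewrite rmorphM (pb_mulr hb) rmorphD !rmorphM /= !fK.
Qed.

(** * The algebra isomorphism between A_mu and the quotient of T *)

Section Comparison.
Variables (k : fieldType) (n : nat) (R : comAlgType k) (br : R -> R -> R).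
Variables (d : 'I_n -> R -> R) (a : 'I_n -> R) (mu gamma : 'I_n -> 'I_n -> k).

Lemma gwpa_generated :
  generated (xy_gen n n (gwpa_const a) (gwpa_x a) (gwpa_y a)).
Proof.
apply: (generatedS _ (quot_generated (gP := @gwpa_proper k n R a)
  (mpoly_generated (A := R) (m := n + n)))).
move=> _ [_ [[r ->]|[i ->]] ->]; first exact: XyC.
case: (splitP i) => [j ij|j ij].
  have -> : i = lshift n j by apply: val_inj.
  exact: (XyX _ _ (gwpa_x a)).
have -> : i = rshift n j by apply: val_inj.
exact: (XyY _ _ _ (gwpa_y a)).
Qed.

(** The two tables differ only in the order of x and y, and antisymmetry passes between them. *)
Lemma gwpa_bracketE (b : gwpa a -> gwpa a -> gwpa a) : poisson_bracket b ->
  gwpa_bracket br d mu gamma b <->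
  xy_rules br d a mu gamma n n (gwpa_const a) (gwpa_x a) (gwpa_y a) b.
Proof.
move=> hb; split=> hr.
  split=> [r s|r i _|r i _|i _ _|i j _ _ ij|i j _ _ ij|i j _ _ ij].
  - exact: (gwpa_rr hr).
  - exact: (gwpa_rx hr).
  - exact: (gwpa_ry hr).
  - by rewrite (pb_antisym hb) (gwpa_yx hr).
  - by rewrite (pb_antisym hb) (gwpa_yx_neq hr) 1?eq_sym // scaleNr.
  - exact: (gwpa_xx hr).
  - exact: (gwpa_yy hr).
split=> // [r s|r i|r i|i|i j ij|i j ij|i j ij].
- exact: (xy_cc hr).
- exact: (xy_cx hr).
- exact: (xy_cy hr).
- by rewrite (pb_antisym hb) (xy_xy hr) // opprK.
- by rewrite (pb_antisym hb) (xy_xy_neq hr) 1?eq_sym // scaleNr opprK.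
- exact: (xy_xx hr).
- exact: (xy_yy hr).
Qed.

Let pi := quot_pi (@oreT_proper k n R a).
Definition quotT_const (r : R) : quotT a := pi (iconst n (iconst n r)).
Definition quotT_x (i : 'I_n) : quotT a := pi (iconst n (ivar R n i)).
Definition quotT_y (i : 'I_n) : quotT a := pi (ivar (oreT0 n R) n i).

Lemma quotT_generated : generated (xy_gen n n quotT_const quotT_x quotT_y).
Proof.
apply: (generatedS _ (quot_generated (gP := @oreT_proper k n R a)
  (oreT_generated (R := R) (leqnn n)))) => _ [_ [r|i _|i _] ->].
- exact: XyC.
- exact: (XyX _ _ quotT_x).
- exact: (XyY _ _ _ quotT_y).
Qed.

Lemma gwpa_to_quotT : exists f : {lrmorphism gwpa a -> quotT a},
  [/\ forall r, f (gwpa_const a r) = quotT_const r,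
      forall i, f (gwpa_x a i) = quotT_x i
    & forall i, f (gwpa_y a i) = quotT_y i].
Proof.
pose c : {lrmorphism R -> quotT a} :=
  pi \o (@iconst k (ipoly R n) n \o @iconst k R n).
have [f0 [f0C f0X]] := @mpoly_hom k R (quotT a) (n + n) c
  (fun i => match split i with inl j => quotT_x j | inr j => quotT_y j end).
have f0x j : f0 (mpoly.mpolyX R (mpoly.mnm1 (lshift n j))) = quotT_x j.
  by rewrite f0X (unsplitK (inl j)).
have f0y j : f0 (mpoly.mpolyX R (mpoly.mnm1 (rshift n j))) = quotT_y j.
  by rewrite f0X (unsplitK (inr j)).
have [i|f fE] := quot_hom (@gwpa_proper k n R a) (f := f0).
  rewrite /gwpa_rel rmorphB rmorphM /= f0x f0y f0C -rmorphM -rmorphB.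
  exact: (quot_pi_gen (@oreT_proper k n R a)).
by exists f; split=> [r|i|i]; rewrite [LHS]fE ?f0C ?f0x ?f0y.
Qed.

Lemma quotT_to_gwpa : exists g : {lrmorphism quotT a -> gwpa a},
  [/\ forall r, g (quotT_const r) = gwpa_const a r,
      forall i, g (quotT_x i) = gwpa_x a i
    & forall i, g (quotT_y i) = gwpa_y a i].
Proof.
have [mC mCE] := mpolyC_hom R (n + n).
pose q : {lrmorphism mpolyAlg R (n + n) -> gwpa a} := quot_pi (@gwpa_proper k n R a).
have [g0 [g0C g0X]] := ipoly_hom n (q \o mC : {lrmorphism R -> gwpa a})
  (extend_ord 0 (gwpa_x a)).
have [g1 [g1C g1Y]] := ipoly_hom n g0 (extend_ord 0 (gwpa_y a)).
have g1c r : g1 (iconst n (iconst n r)) = gwpa_const a r.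
  by rewrite g1C g0C /= mCE.
have g1x (i : 'I_n) : g1 (iconst n (ivar R n i)) = gwpa_x a i.
  by rewrite g1C g0X // extend_ordE.
have g1y (i : 'I_n) : g1 (ivar (ipoly R n) n i) = gwpa_y a i.
  by rewrite g1Y // extend_ordE.
have [i|g gE] := quot_hom (@oreT_proper k n R a) (f := g1).
  rewrite /oreT_rel rmorphB rmorphM /= g1c g1x g1y -rmorphM -rmorphB.
  exact: (quot_pi_gen (@gwpa_proper k n R a)).
by exists g; split=> [r|i|i]; rewrite [LHS]gE ?g1c ?g1x ?g1y.
Qed.

(** The two maps exchange the generators, so both composites fix generators and are identities. *)
Lemma gwpa_quotT_iso : exists (f : {lrmorphism gwpa a -> quotT a})
    (g : {lrmorphism quotT a -> gwpa a}),
  [/\ cancel f g, cancel g f,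
      forall r, g (quotT_const r) = gwpa_const a r,
      forall i, g (quotT_x i) = gwpa_x a i
    & forall i, g (quotT_y i) = gwpa_y a i].
Proof.
have [f [fc fx fy]] := gwpa_to_quotT; have [g [gc gx gy]] := quotT_to_gwpa.
exists f, g; split=> //.
  apply: (generated_id (f := g \o f) gwpa_generated).
  by move=> _ [r|i _|i _]; rewrite /= ?fc ?fx ?fy.
apply: (generated_id (f := f \o g) quotT_generated).
by move=> _ [r|i _|i _]; rewrite /= ?gc ?gx ?gy.
Qed.

End Comparison.

Theorem theorem2p6 (k : fieldType) (n : nat) (R : comAlgType k)
    (br : R -> R -> R) (d : 'I_n -> R -> R) (a : 'I_n -> R)
    (mu gamma : 'I_n -> 'I_n -> k)
    (hn : (0 < n)%N)
    (hbr : poisson_bracket br)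
    (hd : forall i, poisson_derivation br (d i))
    (hdC : forall i j r, d i (d j r) = d j (d i r))
    (ha_reg : forall i, GRing.lreg (a i))
    (ha_central : forall i, poisson_central br (a i))
    (hda : forall i j, i != j -> d j (a i) = gamma i j *: a i)
    (hgm : forall i j, i != j -> gamma i j + gamma j i = mu i j + mu j i) :
  [/\ exists bA : gwpa a -> gwpa a -> gwpa a, gwpa_bracket br d mu gamma bA,
      exists bT : oreT n R -> oreT n R -> oreT n R,
        oreT_bracket br d a mu gamma bT
    & forall (bA : gwpa a -> gwpa a -> gwpa a)
             (bT : oreT n R -> oreT n R -> oreT n R),
        gwpa_bracket br d mu gamma bA -> oreT_bracket br d a mu gamma bT ->
        exists2 bQ : quotT a -> quotT a -> quotT a,
          quotient_bracket bT bQ & poisson_isomorphic bA bQ].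
Proof.
have [bT hT] : exists bT : oreT n R -> oreT n R -> oreT n R,
    oreT_bracket br d a mu gamma bT.
  have [b0 h0] := oreT0_exists a hbr hd hdC hgm (leqnn n).
  have [hb0 hr0] := oreT0_rules a hbr hgm (leqnn n) h0.
  have [bT hT] := oreT_stage_exists hbr hd hdC ha_central hda hgm hb0 hr0 (leqnn n).
  by exists bT, b0.
have [f [g [fK gK gc gx gy]]] := gwpa_quotT_iso a.
(* Serves both the existence of the bracket on A_mu and the comparison with a given one. *)
have transport (b : oreT n R -> oreT n R -> oreT n R) :
    oreT_bracket br d a mu gamma b ->
    exists bQ : quotT a -> quotT a -> quotT a, quotient_bracket b bQ /\
      gwpa_bracket br d mu gamma (fun u v => g (bQ (f u) (f v))).
  move=> [b0 h0 hb]; have [hb0 hr0] := oreT0_rules a hbr hgm (leqnn n) h0.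
  have [pb rb] := oreT_rules hgm hb0 hr0 (leqnn n) hb.
  have [|bQ hQ] := quotient_bracket_exists (@oreT_proper k n R a) pb.
    move=> i v.
    exact: (rel_poisson pb rb ha_central hda i v erefl erefl
      (oreT_generated (R := R) (leqnn n))).
  exists bQ; split=> //; case: hQ => pQ hQ.
  have pA := transport_poisson fK gK pQ.
  apply/(gwpa_bracketE _ _ _ _ pA).
  have rQ : xy_rules br d a mu gamma n n (quotT_const a) (quotT_x a) (quotT_y a) bQ.
    exact: (xy_rules_map (f := quot_pi (@oreT_proper k n R a)) _ _ _ hQ rb).
  by apply: (xy_rules_map gc gx gy _ rQ) => u v; rewrite !gK.
split; [have [bQ [_ hA]] := transport bT hT | by exists bT |].
  by exists (fun u v => g (bQ (f u) (f v))).
(* The given [bA] and the pullback of [bQ] obey the same table, hence coincide, so [f] preserves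
   brackets. *)
move=> bA {hT}bT hA /transport [bQ [hQ hA']]; exists bQ => //.
exists f; first by exists g.
have pA := gwpa_poisson hA; have pA' := gwpa_poisson hA'.
move: hA hA' => /(gwpa_bracketE _ _ _ _ pA) rA /(gwpa_bracketE _ _ _ _ pA') rA' u v.
by rewrite (xy_bracket_unique (gwpa_generated (a := a)) pA pA' rA rA') gK.
Qed.
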